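(* Fix a constant integer $t \geq 1$. There is a deterministic polynomial-time algorithm with access to an oracle for \textsc{Sat} (satisfiability of propositional formulas) that decides the decision version of $t$-\textsc{Isp}: given a CNF formula $\varphi$ over a set of Boolean features $\mathcal{F}$, a set of concrete features $\mathcal{C} \subseteq \mathcal{F}$, and an integer $s \geq 0$, decide whether there exists a sample with $t$-wise coverage consisting of at most $s$ configurations. The algorithm makes $\mathcal{O}(\log |\mathcal{C}|)$ queries to the oracle.
   Context: A propositional formula $\varphi$ in conjunctive normal form is given over Boolean variables $\mathcal{F}=\{x_1,\dots,x_n\}$ (called features). Each feature $x$ has two literals, $x$ and $\overline{x}$. A configuration is an assignment of truth values to all features, identified with the set of literals it makes true; a configuration is valid if it satisfies $\varphi$, and only valid configurations are called configurations. A subset $\mathcal{C}\subseteq\mathcal{F}$ is given as the set of concrete features; literals of concrete features are concrete literals. An interaction of size $t$ is a set of $t$ concrete literals. An interaction $I$ is feasible if some valid configuration $C$ satisfies $C \supseteq I$; then $C$ covers $I$. A sample is a set $S$ of valid configurations; it has $t$-wise coverage if every feasible interaction of size $t$ is covered by some configuration in $S$. The problem $t$-\textsc{Isp} asks for a minimum-cardinality sample with $t$-wise coverage; its decision version additionally takes a bound $s$ and asks whether a sample with $t$-wise coverage of size at most $s$ exists. *)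

(* Defs.v *)
From mathcomp Require Import all_boot.

Set Implicit Arguments.
Unset Strict Implicit.
Unset Printing Implicit Defensive.

(* The literals [x] and [not x] of a feature [x] are [(x, true)] and
   [(x, false)]. *)
Notation literal n := ('I_n * bool)%type.

Definition cnf (n : nat) : Type := seq (seq (literal n)).

Notation assignment n := {ffun 'I_n -> bool}.

Definition true_literals n (a : assignment n) : {set literal n} :=
  [set l | a l.1 == l.2].

Definition valid n (phi : cnf n) (a : assignment n) : bool :=
  all (has (fun l => l \in true_literals a)) phi.

Definition concrete_literals n (C : {set 'I_n}) : {set literal n} :=
  [set l | l.1 \in C].

(* An interaction may contain both literals of a feature; it is then
   infeasible. *)
Definition interaction n (C : {set 'I_n}) (t : nat) (I : {set literal n}) : Prop :=
  I \subset concrete_literals C /\ #|I| = t.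

Definition covers n (a : assignment n) (I : {set literal n}) : bool :=
  I \subset true_literals a.

Definition feasible n (phi : cnf n) (I : {set literal n}) : Prop :=
  exists a, valid phi a /\ covers a I.

Definition sample n (phi : cnf n) (S : {set assignment n}) : Prop :=
  forall a, a \in S -> valid phi a.

Definition twise_coverage n (phi : cnf n) (C : {set 'I_n}) (t : nat)
    (S : {set assignment n}) : Prop :=
  forall I, interaction C t I -> feasible phi I ->
    exists a, a \in S /\ covers a I.

Record isp_instance : Type := IspInstance {
  features : nat;
  model : cnf features;
  concrete : {set 'I_features};
  bound : nat }.

Definition isp_decision (t : nat) (x : isp_instance) : Prop :=
  exists S : {set assignment (features x)},
    [/\ sample (model x) S,
        twise_coverage (model x) (concrete x) t S
      & #|S| <= bound x].

(* [n] ones closed by a zero.  Feature indices may be written in unary: an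
   instance lists its features, so its length is at least their number and the
   length of the encoding stays polynomially related to the one obtained with
   binary indices. *)
Definition encode_unary (n : nat) : seq bool := nseq n true ++ [:: false].

Definition encode_seq (T : Type) (e : T -> seq bool) (s : seq T) : seq bool :=
  foldr (fun x w => true :: e x ++ w) [:: false] s.

(* Binary digits, least significant first, without leading zeros. *)
Definition binary (s : nat) : seq bool :=
  mkseq (fun i => odd (s %/ 2 ^ i)) (up_log 2 s.+1).

Definition encode_literal n (l : literal n) : seq bool :=
  l.2 :: encode_unary l.1.

Definition encode_instance (x : isp_instance) : seq bool :=
  encode_unary (features x)
  ++ [seq i \in concrete x | i <- enum 'I_(features x)]
  ++ encode_seq (encode_seq (@encode_literal _)) (model x)
  ++ encode_seq (fun b => [:: b]) (binary (bound x)).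

Inductive formula : Type :=
| Var of nat
| Neg of formula
| And of formula & formula
| Or of formula & formula.

Fixpoint eval (v : nat -> bool) (f : formula) : bool :=
  match f with
  | Var i => v i
  | Neg g => ~~ eval v g
  | And g h => eval v g && eval v h
  | Or g h => eval v g || eval v h
  end.

(* Prefix notation. *)
Fixpoint encode_formula (f : formula) : seq bool :=
  match f with
  | Var i => [:: false, false & encode_unary i]
  | Neg g => [:: false, true & encode_formula g]
  | And g h => [:: true, false & encode_formula g ++ encode_formula h]
  | Or g h => [:: true, true & encode_formula g ++ encode_formula h]
  end.

(* Words that encode no formula are not in the language. *)
Definition SAT (w : seq bool) : Prop :=
  exists f, w = encode_formula f /\ exists v, eval v f.

Lemma encode_unary_prefix i j u w :
  encode_unary i ++ u = encode_unary j ++ w -> i = j /\ u = w.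
Proof.
elim: i j => [|i IH] [|j] //=; first by case.
by case=> /IH[-> ->].
Qed.

Lemma encode_formula_prefix f g u w :
  encode_formula f ++ u = encode_formula g ++ w -> f = g /\ u = w.
Proof.
elim: f g u w => [i|f IH|f1 IH1 f2 IH2|f1 IH1 f2 IH2] [j|g|g1 g2|g1 g2] u w //=.
- by case=> /encode_unary_prefix[-> ->].
- by case=> /IH[-> ->].
- by case; rewrite -!catA => /IH1[->] /IH2[-> ->].
- by case; rewrite -!catA => /IH1[->] /IH2[-> ->].
Qed.

Lemma encode_formula_inj : injective encode_formula.
Proof.
move=> f g eq_fg.
by case: (@encode_formula_prefix f g [::] [::]); rewrite ?cats0.
Qed.

(* Deterministic machines with finitely many stacks of bits and an oracle, with
   their finite control written as a structured program.  Every instruction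
   reads or writes at most one bit (a query replaces the word it asks about,
   which had to be written bit by bit), and costs one unit of time.  A
   multi-tape oracle Turing machine is simulated with constant overhead, a tape
   being two stacks, and conversely. *)
Inductive program : Type :=
| Skip
| Push (r : nat) (b : bool)
| Pop (r : nat) (on_empty on_false on_true : program)
| Seq (p q : program)
| While (r : nat) (p : program)   (* loop as long as stack [r] is not empty *)
| Query (r : nat).                (* replace the word on [r] by the answer *)

Definition store : Type := nat -> seq bool.

Definition update (m : store) (r : nat) (w : seq bool) : store :=
  fun r' => if r' == r then w else m r'.

(* [run A p m m' time queries]: with oracle [A], the program [p] started in
   [m] halts in [m'] after [time] steps, [queries] of which are oracle calls. *)
Inductive run (A : seq bool -> Prop) :
    program -> store -> store -> nat -> nat -> Prop :=
| run_skip m : run A Skip m m 1 0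
| run_push m r b : run A (Push r b) m (update m r (b :: m r)) 1 0
| run_pop_empty m r pe pf pt m' i q :
    m r = [::] -> run A pe m m' i q ->
    run A (Pop r pe pf pt) m m' i.+1 q
| run_pop_false m r w pe pf pt m' i q :
    m r = false :: w -> run A pf (update m r w) m' i q ->
    run A (Pop r pe pf pt) m m' i.+1 q
| run_pop_true m r w pe pf pt m' i q :
    m r = true :: w -> run A pt (update m r w) m' i q ->
    run A (Pop r pe pf pt) m m' i.+1 q
| run_seq m m' m'' p1 p2 i1 i2 q1 q2 :
    run A p1 m m' i1 q1 -> run A p2 m' m'' i2 q2 ->
    run A (Seq p1 p2) m m'' (i1 + i2) (q1 + q2)
| run_while_stop m r p : m r = [::] -> run A (While r p) m m 1 0
| run_while_step m m' m'' r p i1 i2 q1 q2 :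
    m r <> [::] -> run A p m m' i1 q1 -> run A (While r p) m' m'' i2 q2 ->
    run A (While r p) m m'' (i1 + i2).+1 (q1 + q2)
| run_query_yes m r : A (m r) -> run A (Query r) m (update m r [:: true]) 1 1
| run_query_no m r : ~ A (m r) -> run A (Query r) m (update m r [:: false]) 1 1.

Lemma run_deterministic A p m m1 m2 i1 i2 q1 q2 :
  run A p m m1 i1 q1 -> run A p m m2 i2 q2 ->
  [/\ m1 = m2, i1 = i2 & q1 = q2].
Proof.
move=> R1; elim: R1 m2 i2 q2 => {p m m1 i1 q1}.
- by move=> m m2 i2 q2 R; inversion R.
- by move=> m r b m2 i2 q2 R; inversion R.
- move=> m r pe pf pt m' i q mr _ IH m2 i2 q2 R; inversion R; subst; try congruence.
  by match goal with H : run _ pe _ _ _ _ |- _ => case/IH: H => -> -> -> end.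
- move=> m r w pe pf pt m' i q mr _ IH m2 i2 q2 R; inversion R; subst; try congruence.
  match goal with H : m r = false :: ?w' |- _ =>
    have E : w' = w by congruence end; subst.
  by match goal with H : run _ pf _ _ _ _ |- _ => case/IH: H => -> -> -> end.
- move=> m r w pe pf pt m' i q mr _ IH m2 i2 q2 R; inversion R; subst; try congruence.
  match goal with H : m r = true :: ?w' |- _ =>
    have E : w' = w by congruence end; subst.
  by match goal with H : run _ pt _ _ _ _ |- _ => case/IH: H => -> -> -> end.
- move=> m m' m'' p1 p2 i1 i2 q1 q2 _ IH1 _ IH2 m2 j k R; inversion R; subst.
  match goal with H : run _ p1 _ _ _ _ |- _ => case/IH1: H => E1 E2 E3 end; subst.
  by match goal with H : run _ p2 _ _ _ _ |- _ => case/IH2: H => -> -> -> end.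
- by move=> m r p mr m2 i2 q2 R; inversion R.
- move=> m m' m'' r p i1 i2 q1 q2 mr _ IH1 _ IH2 m2 j k R; inversion R; subst => //.
  match goal with H : run _ p _ _ _ _ |- _ => case/IH1: H => E1 E2 E3 end; subst.
  by match goal with H : run _ (While _ _) _ _ _ _ |- _ =>
    case/IH2: H => -> -> -> end.
- by move=> m r Am m2 i2 q2 R; inversion R.
- by move=> m r Am m2 i2 q2 R; inversion R.
Qed.

(* The input is on stack 0, all other stacks are empty. *)
Definition initial (w : seq bool) : store := update (fun=> [::]) 0 w.

(* On input [w], [p] halts within [time] steps and at most [queries] oracle
   calls, leaving on stack 0 the single bit that tells whether [P] holds. *)
Definition decides_within (A : seq bool -> Prop) (p : program)
    (w : seq bool) (P : Prop) (time queries : nat) : Prop :=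
  exists m i q b,
    [/\ run A p (initial w) m i q, m 0 = [:: b], b <-> P,
        i <= time & q <= queries].

(* Main.v *)
Require Import Defs.
From mathcomp Require Import all_boot.
From mathcomp Require Import zify.
From Stdlib Require Import FunctionalExtensionality Classical.

Set Implicit Arguments.
Unset Strict Implicit.
Unset Printing Implicit Defensive.

(** Let [K = (2 |C|) ^ t].  Interactions are counted as [t]-tuples of signed
    features with distinct concrete features; at most [K] of them are feasible,
    and [K] configurations suffice to cover them all.  Whether some [s] valid
    configurations cover at least [k] tuples is one satisfiability question, of
    polynomial size when [s], [k <= K]: guess the configurations and [k] pairwise
    distinct tuples, each with a configuration that covers it.  With [s = K],
    binary search over [k <= K] finds the number of feasible tuples with
    [O(log K) = O(log |C|)] queries.  A sample has [t]-wise coverage exactly if it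
    covers that many tuples, so one more query, with [s] the given bound clamped
    to [K], decides the instance.  The formulas are in prefix notation, so a stack
    that is filled from the back evaluates to the formula like a postfix
    calculator; quantifiers over ranges are loops over numbers kept in unary. *)

(** * Execution within time and query bounds *)

(** Covering every feasible interaction is a universal condition, so it is not by itself a
    satisfiability question. A lower bound on the number of covered tuples is existential, and once
    it equals the number of feasible tuples it forces full coverage, since the tuples covered by a
    sample are always feasible. The bound [s] is written in binary and may be exponential in the
    input, hence the clamping, which loses nothing because [K] configurations suffice. As [t] is
    fixed, [K] is polynomial in the input. A query has to be written bit by bit, so its formula is
    described in a small expression language with loops; correctness and cost of the emission are
    proved once, by induction on expressions. *)

Definition exec (p : program) (m m' : store) (T Q : nat) : Prop :=
  exists i j, [/\ run SAT p m m' i j, i <= T & j <= Q].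

(** Costs are kept as upper bounds, so that they can be weakened at each composition and a loop can
    charge the same amount for every round. *)
Lemma exec_conv p m m1 m2 T1 T2 Q1 Q2 :
  exec p m m1 T1 Q1 -> m1 = m2 -> T1 <= T2 -> Q1 <= Q2 -> exec p m m2 T2 Q2.
Proof.
move=> [i [j [R iT jQ]]] <- TT QQ; exists i, j; split=> //; lia.
Qed.

Lemma exec_conv_eq p m0 m m1 m2 T1 T2 Q1 Q2 :
  exec p m m1 T1 Q1 -> m0 = m -> m1 = m2 -> T1 <= T2 -> Q1 <= Q2 ->
  exec p m0 m2 T2 Q2.
Proof. by move=> R ->; apply: exec_conv R. Qed.

Lemma exec_skip m : exec Skip m m 1 0.
Proof. by exists 1, 0; split=> //; apply: run_skip. Qed.

Lemma exec_push m r b : exec (Push r b) m (update m r (b :: m r)) 1 0.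
Proof. by exists 1, 0; split=> //; apply: run_push. Qed.

Lemma exec_seq m m1 m2 p1 p2 T1 T2 Q1 Q2 :
  exec p1 m m1 T1 Q1 -> exec p2 m1 m2 T2 Q2 ->
  exec (Seq p1 p2) m m2 (T1 + T2) (Q1 + Q2).
Proof.
move=> [i1 [j1 [R1 ? ?]]] [i2 [j2 [R2 ? ?]]].
exists (i1 + i2), (j1 + j2); split; [exact: run_seq R1 R2 | lia | lia].
Qed.

Lemma exec_pop_empty m m' r pe pf pt T Q :
  m r = [::] -> exec pe m m' T Q -> exec (Pop r pe pf pt) m m' T.+1 Q.
Proof.
move=> mr [i [j [R ? ?]]]; exists i.+1, j; split=> //; exact: run_pop_empty.
Qed.

Lemma exec_pop m m' r (b : bool) w pe pf pt T Q :
  m r = b :: w -> exec (if b then pt else pf) (update m r w) m' T Q ->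
  exec (Pop r pe pf pt) m m' T.+1 Q.
Proof.
move=> mr [i [j [R ? ?]]]; exists i.+1, j; split=> //.
by case: b mr R => mr R; [exact: run_pop_true mr R | exact: run_pop_false mr R].
Qed.

Lemma exec_while_stop m r p : m r = [::] -> exec (While r p) m m 1 0.
Proof. by move=> mr; exists 1, 0; split=> //; apply: run_while_stop. Qed.

Lemma exec_while_step m m1 m2 r p T1 T2 Q1 Q2 :
  m r <> [::] -> exec p m m1 T1 Q1 -> exec (While r p) m1 m2 T2 Q2 ->
  exec (While r p) m m2 (T1 + T2).+1 (Q1 + Q2).
Proof.
move=> mr [i1 [j1 [R1 ? ?]]] [i2 [j2 [R2 ? ?]]].
exists (i1 + i2).+1, (j1 + j2); split; [exact: run_while_step R1 R2 | lia | lia].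
Qed.

(** [I i] is the whole store after [i] rounds; the extra unit per round pays for the emptiness
    test. *)
Lemma exec_while n (I : nat -> store) r p T Q :
  (forall i, i < n -> I i r <> [::] /\ exec p (I i) (I i.+1) T Q) ->
  I n r = [::] -> exec (While r p) (I 0) (I n) (n * T.+1 + 1) (n * Q).
Proof.
elim: n I => [|n IH] I step stop; first exact: exec_while_stop.
have [I0 R0] := step 0 isT.
apply: exec_conv.
- apply: exec_while_step I0 R0 _.
  by apply: (IH (fun i => I i.+1)) => // i lt_in; apply: step.
- by [].
- lia.
- lia.
Qed.

(** * Loops over unary numbers and words *)

Definition ones (n : nat) : seq bool := nseq n true.

(** Loop invariants are stated with both counter stacks overwritten, so that the underlying store
    may hold anything there. *)
Definition st (m : store) (r s i j : nat) : store :=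
  update (update m r (ones i)) s (ones j).

Ltac stores := apply: functional_extensionality => ?; rewrite /st /update;
  repeat match goal with
  | |- context [?a == ?b] => case: (@eqP _ a b) => ?
  end; subst;
  try match goal with H : is_true (?a != ?a) |- _ => by rewrite eqxx in H end;
  try lia; try congruence.

Fixpoint emit (r : nat) (w : seq bool) : program :=
  if w is b :: w' then Seq (emit r w') (Push r b) else Skip.

Lemma exec_emit r w m :
  exec (emit r w) m (update m r (w ++ m r)) (size w).+1 0.
Proof.
elim: w => [|b w IH] /=.
  by apply: exec_conv (exec_skip m) _ _ _ => //; stores.
apply: exec_conv (exec_seq IH (exec_push _ _ _)) _ _ _ => //; last lia.
by stores; rewrite eqxx.
Qed.

Definition clear r := While r (Pop r Skip Skip Skip).

Lemma exec_clear r m : exec (clear r) m (update m r [::]) (size (m r) * 3 + 1) 0.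
Proof.
apply: exec_conv_eq (exec_while (n := size (m r)) (T := 2) (Q := 0)
  (I := fun i => update m r (drop i (m r))) _ _) _ _ _ _ => //.
- move=> i lt_i; rewrite (drop_nth false) // /update eqxx; split=> //.
  apply: exec_pop; first by rewrite eqxx.
  have -> : forall b : bool, (if b then Skip else Skip) = Skip by case.
  by apply: exec_conv (exec_skip _) _ _ _ => //; stores.
- by rewrite /update eqxx drop_size.
- by stores; rewrite drop0.
- by stores; rewrite drop_size.
- lia.
Qed.

Lemma exec_seq_eq m m1 m1' m2 p1 p2 T1 T2 Q1 Q2 :
  exec p1 m m1 T1 Q1 -> m1 = m1' -> exec p2 m1' m2 T2 Q2 ->
  exec (Seq p1 p2) m m2 (T1 + T2) (Q1 + Q2).
Proof. by move=> R <-; apply: exec_seq. Qed.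

(** A unit popped from [r] is pushed on [s] after the body, so in round [i] the stack [s] holds [i]
    and serves as the loop variable. *)
Definition countdown r s body :=
  While r (Pop r Skip Skip (Seq body (Push s true))).

Lemma exec_countdown r s body n (I : nat -> store) T Q :
  r != s ->
  (forall i, i < n -> exec body (st (I i) r s (n - i.+1) i)
                                (st (I i.+1) r s (n - i.+1) i) T Q) ->
  exec (countdown r s body) (st (I 0) r s n 0) (st (I n) r s 0 n)
       (n * (T + 3) + 1) (n * Q).
Proof.
move=> rs step.
apply: exec_conv_eq (exec_while (n := n) (T := T.+2) (Q := Q)
  (I := fun i => st (I i) r s (n - i) i) _ _) _ _ _ _.
- move=> i lt_in; rewrite /st.
  have E : n - i = (n - i.+1).+1 by lia.
  split; first by rewrite /update eqxx (negPf rs) E.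
  apply: exec_pop; first by rewrite /update eqxx (negPf rs) E.
  apply: exec_conv_eq (exec_seq (step i lt_in) (exec_push _ _ _)) _ _ _ _; [| |lia..].
  + by rewrite /st; stores.
  + by rewrite /st; stores.
- by rewrite /st /update eqxx (negPf rs) subnn.
- by rewrite subn0.
- by rewrite subnn.
- lia.
- lia.
Qed.

(** The second countdown moves the counter back to [r], so the number survives the loop. *)
Definition for_ones r s body := Seq (countdown r s body) (countdown s r Skip).

Lemma exec_for_ones r s body n (I : nat -> store) m m' T Q :
  r != s -> m = st (I 0) r s n 0 -> m' = st (I n) r s n 0 ->
  (forall i, i < n -> exec body (st (I i) r s (n - i.+1) i)
                                (st (I i.+1) r s (n - i.+1) i) T Q) ->
  exec (for_ones r s body) m m' (n * (T + 7) + 2) (n * Q).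
Proof.
move=> rs -> -> step.
apply: exec_conv_eq (exec_seq (exec_countdown rs step)
  (exec_conv_eq (exec_countdown (I := fun=> I n) (T := 1) (Q := 0) _ _) _ _ (leqnn _)
     (leqnn _))) _ _ _ _.
- by rewrite eq_sym.
- by move=> i lt_i; apply: exec_skip.
- by rewrite /st; stores.
- by [].
- by [].
- by rewrite /st; stores.
- lia.
- lia.
Qed.

Definition move_word r s := While r (Pop r Skip (Push s false) (Push s true)).

Lemma exec_move_word r s m :
  r != s ->
  exec (move_word r s) m (update (update m r [::]) s (rev (m r) ++ m s))
       (size (m r) * 3 + 1) 0.
Proof.
move=> rs.
apply: exec_conv_eq (exec_while (n := size (m r)) (T := 2) (Q := 0)
  (I := fun i => update (update m r (drop i (m r))) s
                        (rev (take i (m r)) ++ m s)) _ _) _ _ _ _.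
- move=> i lt_i.
  have E : update (update m r (drop i (m r))) s (rev (take i (m r)) ++ m s) r =
      nth false (m r) i :: drop i.+1 (m r).
    by rewrite /update eqxx (negPf rs) (drop_nth false lt_i).
  split; first by rewrite E.
  apply: exec_pop; first exact: E.
  have -> : forall b : bool,
    (if b then Push s true else Push s false) = Push s b by case.
  apply: exec_conv (exec_push _ _ _) _ _ _ => //.
  stores.
  by rewrite (take_nth false lt_i) rev_rcons.
- by rewrite /update eqxx (negPf rs) drop_size.
- by stores; rewrite ?take0 ?drop0.
- by stores; rewrite ?take_size ?drop_size.
- lia.
- by rewrite muln0.
Qed.

(* Both copies are made from the reversed word on [u]. *)
Definition copy_word r s u :=
  Seq (move_word r u)
      (While u (Pop u Skip (Seq (Push r false) (Push s false))
                           (Seq (Push r true) (Push s true)))).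

Lemma exec_copy_word r s u m :
  r != s -> r != u -> s != u -> m u = [::] ->
  exec (copy_word r s u) m (update m s (m r ++ m s)) (size (m r) * 7 + 2) 0.
Proof.
move=> rs ru su mu.
apply: exec_conv (exec_seq (exec_move_word m ru) (exec_conv_eq
  (exec_while (n := size (m r)) (T := 3) (Q := 0)
  (I := fun i => update (update (update m u (drop i (rev (m r))))
      r (rev (take i (rev (m r))))) s (rev (take i (rev (m r))) ++ m s)) _ _)
   _ _ (leqnn _) (leqnn _))) _ _ _.
- move=> i; rewrite -size_rev => lt_i.
  have us : u == s = false by rewrite eq_sym; apply/negbTE.
  have ur : u == r = false by rewrite eq_sym; apply/negbTE.
  set mi := update _ s _.
  have E : mi u = nth false (rev (m r)) i :: drop i.+1 (rev (m r)).
    by rewrite /mi /update us ur eqxx (drop_nth false lt_i).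
  split; first by rewrite E.
  apply: exec_pop; first exact: E.
  have -> : forall b : bool,
    (if b then Seq (Push r true) (Push s true)
     else Seq (Push r false) (Push s false)) = Seq (Push r b) (Push s b) by case.
  apply: exec_conv (exec_seq (exec_push _ _ _) (exec_push _ _ _)) _ _ _ => //.
  rewrite {}/mi in E *.
  stores; rewrite ?(take_nth false lt_i) ?rev_rcons //.
- rewrite /update; case: eqP => [us|_]; first by rewrite us eqxx in su.
  case: eqP => [ur|_]; first by rewrite ur eqxx in ru.
  by rewrite eqxx -size_rev drop_size.
- by stores; rewrite ?take0 ?drop0 // mu cats0.
- by [].
- by rewrite -size_rev take_size revK drop_size; stores.
- lia.
- by rewrite muln0.
Qed.

(** [While] only tests a stack for emptiness, but the end of a code is a bit amid the rest of the
    word; the flag [f] turns that bit into a stopping condition. *)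
Definition readseq r f body :=
  Seq (Push f true)
      (While f (Pop r Skip (Pop f Skip Skip Skip) body)).

Lemma exec_readseq (X : Type) (e : X -> seq bool) (s : seq X) r f body w
    (I : seq X -> store) m m' T Q :
  r != f ->
  m = update (update (I [::]) r (encode_seq e s ++ w)) f [::] ->
  m' = update (update (I s) r w) f [::] ->
  (forall pre x post, s = pre ++ x :: post ->
    exec body
      (update (update (I pre) r (e x ++ encode_seq e post ++ w)) f [:: true])
      (update (update (I (rcons pre x)) r (encode_seq e post ++ w)) f [:: true])
      T Q) ->
  exec (readseq r f body) m m' (size s * T.+2 + 6) (size s * Q).
Proof.
move=> rf -> -> step.
pose loop := While f (Pop r Skip (Pop f Skip Skip Skip) body).
suff R pre post : s = pre ++ post ->
    exec loop (update (update (I pre) r (encode_seq e post ++ w)) f [:: true])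
      (update (update (I s) r w) f [::]) (size post * T.+2 + 5) (size post * Q).
  rewrite /readseq -/loop.
  apply: exec_conv (exec_seq_eq (exec_push _ _ _) _ (R [::] s erefl)) _ _ _ => //.
    by stores.
  lia.
elim: post pre => [|x post IH] pre def_s.
  rewrite cats0 in def_s; rewrite -def_s.
  have fr : f == r = false by rewrite eq_sym (negPf rf).
  apply: exec_conv.
  - apply: exec_while_step.
    + by rewrite /update eqxx.
    + apply: (exec_pop (b := false) (w := w)).
        by rewrite /update eqxx (negPf rf).
      apply: (exec_pop (b := true) (w := [::])); last exact: exec_skip.
      by rewrite /update eqxx fr.
    + by apply: exec_while_stop; rewrite /update eqxx.
  - by stores.
  - by [].
  - by [].
have {}IH := IH (rcons pre x); rewrite cat_rcons in IH.
apply: exec_conv.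
- apply: exec_while_step (IH def_s); first by rewrite /update eqxx.
  apply: (exec_pop (b := true)); first by rewrite /update (negPf rf) eqxx /= -catA.
  apply: exec_conv_eq (step _ _ _ def_s) _ erefl (leqnn _) (leqnn _).
  by stores.
- by [].
- by rewrite /=; lia.
- by rewrite /=; lia.
Qed.

(** * Emission of variables and of the model *)

Ltac upd := rewrite /st /update /=;
  repeat match goal with
  | |- context [?a == ?b] => case: (@eqP _ a b) => ?
  end; subst;
  try match goal with H : is_true (?a != ?a) |- _ => by rewrite eqxx in H end;
  try lia; try congruence.

Lemma catA_ones i j w : ones i ++ ones j ++ w = ones (i + j) ++ w.
Proof. by rewrite catA /ones nseqD. Qed.

Definition add_ones e r s q := for_ones r s (emit q (ones e)).

Lemma exec_add_ones e r s q n m :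
  r != s -> q != r -> q != s -> m r = ones n -> m s = [::] ->
  exec (add_ones e r s q) m (update m q (ones (n * e) ++ m q)) (n * (e + 8) + 2) 0.
Proof.
move=> rs qr qs mr ms.
apply: exec_conv (exec_for_ones (n := n) (T := e.+1) (Q := 0)
  (I := fun i => update m q (ones (i * e) ++ m q)) rs _ erefl _) _ _ _.
- by stores.
- move=> i lt_i; apply: exec_conv (exec_emit _ _ _) _ _ _ => //.
    by stores; rewrite catA_ones mulSn.
  by rewrite size_nseq.
- by stores.
- lia.
- lia.
Qed.

Definition mul_ones e r s r' s' q := for_ones r s (add_ones e r' s' q).

Lemma exec_mul_ones e r s r' s' q n n' m :
  uniq [:: r; s; r'; s'; q] -> m r = ones n -> m s = [::] ->
  m r' = ones n' -> m s' = [::] ->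
  exec (mul_ones e r s r' s' q) m (update m q (ones (n * (n' * e)) ++ m q))
       (n * (n' * (e + 8) + 9) + 2) 0.
Proof.
rewrite /= !inE !negb_or andbT => /and4P[/and4P[rs rr' rs' rq] /and3P[sr' ss' sq]].
move=> /andP[r's' r'q] s'q mr ms mr' ms'.
apply: exec_conv (exec_for_ones (n := n) (T := n' * (e + 8) + 2) (Q := 0)
  (I := fun i => update m q (ones (i * (n' * e)) ++ m q)) rs _ erefl _) _ _ _.
- by stores.
- move=> i lt_i.
  apply: exec_conv (exec_add_ones (n := n') _ _ _ _ _ _) _ _ _ => //.
  + by rewrite eq_sym.
  + by rewrite eq_sym.
  + by upd.
  + by upd.
  + by stores; rewrite catA_ones mulSn.
- by stores.
- lia.
- lia.
Qed.

(** The word is pushed from its end: closing zero, ones, tag. With indices in unary, the sum of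
    products that numbers a variable is just nested loops that push ones. *)
Definition emit_var i j l :=
  Seq (Push 0 false) (Seq (add_ones 1 l 9 0) (Seq (mul_ones 1 j 9 7 10 0)
  (Seq (mul_ones 1 i 9 8 10 0) (emit 0 [:: false; false])))).

Definition cost_var N := N * 9 + (N * (N * 9 + 9)).*2 + 10.

Definition free r := r \notin [:: 0; 7; 8; 9; 10].

Lemma exec_emit_var i j l a b c M M2 N m :
  free i -> free j -> free l ->
  m i = ones a -> m j = ones b -> m l = ones c ->
  m 7 = ones M -> m 8 = ones M2 -> m 9 = [::] -> m 10 = [::] ->
  a <= N -> b <= N -> c <= N -> M <= N -> M2 <= N ->
  exec (emit_var i j l) m
    (update m 0 (encode_formula (Var (a * M2 + b * M + c)) ++ m 0))
    (cost_var N) 0.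
Proof.
rewrite /free !inE !negb_or => /and5P[i0 i7 i8 i9 i10] /and5P[j0 j7 j8 j9 j10].
move=> /and5P[l0 l7 l8 l9 l10] mi mj ml m7 m8 m9 m10 aN bN cN MN M2N.
apply: exec_conv.
- apply: exec_seq (exec_push _ _ _) _.
  apply: exec_seq.
    by apply: (exec_add_ones (n := c) _ _ _ _ _); rewrite 1?eq_sym //; upd.
  apply: exec_seq.
    apply: (exec_mul_ones (n := b) (n' := M) _ _ _ _ _); try by upd.
    by rewrite /= !inE !negb_or j7 j9 j10 j0.
  apply: exec_seq.
    apply: (exec_mul_ones (n := a) (n' := M2) _ _ _ _ _); try by upd.
    by rewrite /= !inE !negb_or i8 i9 i10 i0.
  exact: exec_emit.
- stores; rewrite /= !muln1 !catA_ones /encode_unary -catA /=.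
  by [].
- rewrite /cost_var /=; nia.
- by [].
Qed.

Lemma size_encode_seq (T : Type) (e : T -> seq bool) s :
  size s <= size (encode_seq e s).
Proof. by elim: s => //= x s IH; rewrite size_cat; lia. Qed.

Lemma size_encode_seq_mem (T : Type) (e : T -> seq bool) pre x post :
  size (e x) <= size (encode_seq e (pre ++ x :: post)).
Proof. by elim: pre => /= [|y pre IH]; rewrite size_cat; lia. Qed.

Definition read_ones r f s := readseq r f (Push s true).

Lemma exec_read_ones r f s x w m :
  r != f -> s != r -> s != f -> m f = [::] -> m r = encode_unary x ++ w ->
  exec (read_ones r f s) m (update (update m r w) s (ones x ++ m s)) (x * 3 + 6) 0.
Proof.
move=> rf sr sf mf mr.
(* A unary code is the code of a list of [x] units with empty codes, so the rule for lists
   applies. *)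
have E u : ones x ++ false :: u = encode_seq (fun=> [::]) (nseq x tt) ++ u.
  by elim: x {mr} => //= x ->.
apply: exec_conv (exec_readseq (e := fun=> [::]) (s := nseq x tt) (w := w)
  (T := 1) (Q := 0) (I := fun p => update m s (ones (size p) ++ m s)) rf _
  erefl _) _ _ _.
- by rewrite -E; stores; rewrite // mr /encode_unary -catA.
- move=> pre [] post _; apply: exec_conv (exec_push _ _ _) _ _ _ => //.
  by stores; rewrite // size_rcons.
- by stores; rewrite // size_nseq.
- by rewrite size_nseq.
- by rewrite muln0.
Qed.

(** Formulas have no constants; the values of these two do not depend on variable 0. *)
Definition verum := Or (Var 0) (Neg (Var 0)).
Definition falsum := And (Var 0) (Neg (Var 0)).

Section CnfFormula.

Context (n : nat) (f : nat -> nat).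

Definition lit_formula (l : literal n) :=
  if l.2 then Var (f l.1) else Neg (Var (f l.1)).

(** Folding from the left matches the machine: each literal read is put in front of what is already
    on the stack, so the last one ends up outermost. *)
Definition clause_formula (c : seq (literal n)) :=
  foldl (fun a l => Or (lit_formula l) a) falsum c.

Definition cnf_formula (phi : cnf n) :=
  foldl (fun a c => And (clause_formula c) a) verum phi.

Lemma eval_cnf_formula v phi :
  eval v (cnf_formula phi) = all (has (fun l : literal n => v (f l.1) == l.2)) phi.
Proof.
have evl l : eval v (lit_formula l) = (v (f l.1) == l.2).
  by rewrite /lit_formula; case: l.2 => /=; case: (v _).
have evc c : eval v (clause_formula c) = has (fun l : literal n => v (f l.1) == l.2) c.
  rewrite -[RHS]orbF -[in RHS](andbN (v 0)) /clause_formula.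
  rewrite -[v 0 && _]/(eval v falsum).
  elim: c falsum => [|l c IH] F //=; rewrite IH /= evl.
  by rewrite orbA (orbC (has _ _)).
rewrite -[RHS]andbT -[in RHS](orbN (v 0)) /cnf_formula.
rewrite -[v 0 || _]/(eval v verum).
elim: phi verum => [|c phi IH] F //=; rewrite IH /= evc.
by rewrite andbA (andbC (all _ _)).
Qed.

End CnfFormula.

Definition parse_literal r :=
  Seq (read_ones 11 15 12) (Seq (emit_var r 2 12) (clear 12)).

Definition parse_clause r :=
  Pop 11 Skip (Seq (parse_literal r) (emit 0 [:: true; true; false; true]))
              (Seq (parse_literal r) (emit 0 [:: true; true])).

Definition parse_cnf r :=
  Seq (emit 0 (encode_formula verum))
      (readseq 11 13 (Seq (emit 0 (encode_formula falsum))
         (Seq (readseq 11 14 (parse_clause r)) (emit 0 [:: true; false])))).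

(* The contents of the stacks that every emission of a variable relies on: the
   variable [(i, j, l)] is numbered [i * M2 + j * M + l]. *)
Record ready (N t M M2 : nat) (m : store) : Prop := Ready {
  ready2 : m 2 = ones t; ready7 : m 7 = ones M; ready8 : m 8 = ones M2;
  ready9 : m 9 = [::]; ready10 : m 10 = [::]; ready12 : m 12 = [::];
  ready15 : m 15 = [::];
  ready_t : t <= N; ready_M : M <= N; ready_M2 : M2 <= N }.

Definition cost_lit N := N * 3 + 6 + (cost_var N + (N * 3 + 1)) + 6.
Definition cost_cnf N :=
  (size (encode_formula verum)).+1 +
  (N * ((size (encode_formula falsum)).+1 + ((N * (cost_lit N).+3 + 6) + 3)).+2 + 6).

(** Stacks for parameters and loop variables; emission and parsing leave their contents intact. *)
Definition low r := (r \in [:: 1; 2; 5; 6]) || (20 <= r).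

Lemma low_free r : low r -> free r.
Proof. by rewrite /low /free !inE; lia. Qed.

Lemma low_neq r : low r -> [/\ r <> 11, r <> 12, r <> 13, r <> 14 & r <> 15].
Proof. by rewrite /low !inE => h; split; lia. Qed.

Lemma exec_parse_literal r c x w N t M M2 m :
  low r -> ready N t M M2 m -> m r = ones c -> c <= N -> x <= N ->
  m 11 = encode_unary x ++ w ->
  exec (parse_literal r) m
    (update (update m 11 w) 0
       (encode_formula (Var (c * M2 + t * M + x)) ++ m 0))
    (N * 3 + 6 + (cost_var N + (N * 3 + 1))) 0.
Proof.
move=> lr [m2 m7 m8 m9 m10 m12 m15 tN MN M2N] mr cN xN m11.
have [? ? ? ? ?] := low_neq lr; have fr := low_free lr.
have r0 : r <> 0 by move: fr; rewrite /free !inE; lia.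
apply: exec_conv.
- apply: exec_seq.
    by apply: (exec_read_ones (x := x) (w := w)) => //.
  apply: exec_seq.
    apply: (exec_emit_var (a := c) (b := t) (c := x) (M := M) (M2 := M2) (N := N));
      rewrite //; try by upd.
    by upd; rewrite ?m12 ?cats0.
  exact: exec_clear.
- stores. 
- rewrite /update /= m12 cats0 size_nseq; lia.
- by [].
Qed.

Lemma exec_parse_clause r c n (l : literal n) F u w N t M M2 m :
  low r -> ready N t M M2 m -> m r = ones c -> c <= N -> n <= N ->
  m 11 = encode_literal l ++ w -> m 0 = encode_formula F ++ u ->
  exec (parse_clause r) m
    (update (update m 11 w) 0 (encode_formula
       (Or (lit_formula (fun x => c * M2 + t * M + x) l) F) ++ u))
    (cost_lit N).+1 0.
Proof.
case: l => x b lr rd mr cN nN m11 m0.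
have [r11 _ _ _ _] := low_neq lr.
have xN : x <= N by have := ltn_ord x; lia.
apply: (exec_pop (b := b) (w := encode_unary x ++ w)) => //.
set m1 := update m 11 _.
have R : exec (parse_literal r) m1
    (update (update m1 11 w) 0
       (encode_formula (Var (c * M2 + t * M + x)) ++ m1 0))
    (N * 3 + 6 + (cost_var N + (N * 3 + 1))) 0.
  apply: exec_parse_literal => //; first by case: rd; constructor.
  by rewrite /m1; upd.
case: {m11} b; (apply: exec_conv; first exact: exec_seq R (exec_emit _ _ _)).
- by rewrite /lit_formula /m1; stores; rewrite /= ?m0 -?catA.
- by rewrite /cost_lit /=; lia.
- by [].
- by rewrite /lit_formula /m1; stores; rewrite /= ?m0 -?catA.
- by rewrite /cost_lit /=; lia.
- by [].
Qed.

Lemma exec_parse_cnf r c n (phi : cnf n) w N t M M2 m :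
  low r -> ready N t M M2 m -> m r = ones c -> c <= N -> n <= N ->
  size (encode_seq (encode_seq (@encode_literal n)) phi) <= N ->
  m 11 = encode_seq (encode_seq (@encode_literal n)) phi ++ w ->
  m 13 = [::] -> m 14 = [::] ->
  exec (parse_cnf r) m
    (update (update m 11 w) 0 (encode_formula
       (cnf_formula (fun x => c * M2 + t * M + x) phi) ++ m 0))
    (cost_cnf N) 0.
Proof.
set f := fun x => _; move=> lr rd mr cN nN sizeN m11 m13 m14.
have [r11 r12 r13 r14 r15] := low_neq lr.
have r0 : r <> 0 by move: (low_free lr); rewrite /free !inE; lia.
have [? m7 ? m9 ? ? m15 _ _ _] := rd.
apply: exec_conv.
- apply: exec_seq; first exact: exec_emit.
  apply: (exec_readseq (e := encode_seq (@encode_literal n)) (s := phi) (w := w) (Q := 0)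
    (T := (size (encode_formula falsum)).+1 + ((N * (cost_lit N).+3 + 6) + 3))
    (I := fun p => update m 0 (encode_formula (cnf_formula f p) ++ m 0))
    _ _ erefl) => //.
    by stores.
  move=> pre cl post def_phi; set w' := encode_seq _ post ++ w.
  set m1 := update _ 13 _.
  have sizecl : size cl <= N.
    apply: leq_trans (size_encode_seq (@encode_literal n) cl) _.
    by apply: leq_trans sizeN; rewrite def_phi; apply: size_encode_seq_mem.
  apply: exec_conv.
  + apply: exec_seq; first exact: exec_emit.
    apply: exec_seq _ (exec_emit _ _ _).
    apply: (exec_readseq (e := @encode_literal n) (s := cl) (w := w')
      (Q := 0) (T := (cost_lit N).+1)
      (I := fun p => update m1 0 (encode_formula (clause_formula f p) ++ m1 0))
      _ _ erefl) => //.
      by rewrite /m1; stores.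
    move=> p l q _; set w'' := encode_seq _ q ++ w'.
    apply: exec_conv.
    * apply: (exec_parse_clause (F := clause_formula f p) (u := m1 0)
        (w := w'') (l := l) (N := N) (c := c) (t := t) (M := M) (M2 := M2));
        rewrite // /m1; try by upd.
      by case: rd => *; constructor; upd.
    * by rewrite -/f /m1 /clause_formula -cats1 foldl_cat; stores.
    * by [].
    * by [].
  + rewrite /m1 /cnf_formula -cats1 foldl_cat /=.
    by stores; rewrite //= -?catA.
  + rewrite [size [:: _; _]]/=; nia.
  + by rewrite muln0.
- by stores.
- rewrite /cost_cnf.
  have := leq_trans (size_encode_seq (encode_seq (@encode_literal n)) phi) sizeN.
  by rewrite leq_add2l leq_add2r leq_mul2r orbC => ->.
- by rewrite muln0.
Qed.

(** * Compilation of bounded quantifiers *)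

Arguments emit : simpl never.

(** Arguments are stack numbers: [FVar] takes its three coordinates from stacks, the first argument
    of [FAll] and [FEx] is the stack with the strict upper bound, [FBit r] tests the concrete bit at
    the position on [r], and [FCnf r] is the model evaluated on the configuration numbered by
    [r]. *)
Inductive fexp : Type :=
| FVar of nat & nat & nat
| FNot of fexp
| FAnd of fexp & fexp
| FOr of fexp & fexp
| FAll of nat & fexp
| FEx of nat & fexp
| FBit of nat
| FCnf of nat.

Lemma exec_drop r n m :
  r != 9 -> r != 11 -> m r = ones n -> m 9 = [::] ->
  exec (for_ones r 9 (Pop 11 Skip Skip Skip)) m (update m 11 (drop n (m 11)))
       (n * 9 + 2) 0.
Proof.
move=> r9 r11 mr m9; set u := m 11.
apply: exec_conv_eq (exec_for_ones (n := n) (T := 2) (Q := 0)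
  (I := fun i => update m 11 (drop i u)) r9 erefl erefl _) _ _ _ _.
- move=> i lt_i; set m1 := st _ _ _ _ _.
  have E : m1 11 = drop i u by rewrite /m1; upd.
  have := drop_drop u 1 i; rewrite add1n drop1.
  case D: (drop i u) => [|x v] /= D1; rewrite D in E.
    apply: exec_conv; first by [apply: (exec_pop_empty _ _ E (exec_skip _))].
    - by rewrite -D1 /m1; stores.
    - by [].
    - by [].
  apply: (exec_pop _ E).
  have -> : (if x then Skip else Skip) = Skip by case: (x).
  apply: exec_conv (exec_skip _) _ _ _ => //.
  by rewrite -D1 /m1; stores.
- by stores; rewrite // drop0.
- by stores.
- lia.
- by rewrite muln0.
Qed.

Definition emit_bit :=
  Pop 11 (emit 0 (encode_formula falsum)) (emit 0 (encode_formula falsum))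
         (emit 0 (encode_formula verum)).

Lemma exec_emit_bit i cb m :
  m 11 = drop i cb ->
  exec emit_bit m (update (update m 11 (drop i.+1 cb)) 0
    (encode_formula (if nth false cb i then verum else falsum) ++ m 0)) 12 0.
Proof.
move=> E; case: (ltnP i (size cb)) => [lt_i|ge_i].
  rewrite (drop_nth false lt_i) in E; apply: (exec_pop _ E).
  case: (nth _ _ _);
    (apply: exec_conv; [exact: exec_emit | by stores | by [] | by []]).
rewrite drop_oversize // in E; apply: (exec_pop_empty _ _ E).
rewrite nth_default // drop_oversize; last exact: leqW.
by apply: exec_conv; [exact: exec_emit | stores | by [] | by []].
Qed.

(* The stack of the loop variable at nesting depth [d]; the iterations that
   remain are on the next stack. *)
Definition lv d := 20 + d.*2.

Definition scoped d r := (r \in [:: 1; 2; 5; 6]) || [&& 20 <= r, r < lv d & ~~ odd r].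

Fixpoint well_scoped d e := match e with
| FVar i j l => [&& scoped d i, scoped d j & scoped d l]
| FNot e => well_scoped d e
| FAnd e1 e2 | FOr e1 e2 => well_scoped d e1 && well_scoped d e2
| FAll b e | FEx b e => scoped d b && well_scoped d.+1 e
| FBit r | FCnf r => scoped d r
end.

Fixpoint compile d e := match e with
| FVar i j l => emit_var i j l
| FNot e => Seq (compile d e) (emit 0 [:: false; true])
| FAnd e1 e2 => Seq (compile d e2) (Seq (compile d e1) (emit 0 [:: true; false]))
| FOr e1 e2 => Seq (compile d e2) (Seq (compile d e1) (emit 0 [:: true; true]))
| FAll b e =>
  Seq (emit 0 (encode_formula verum)) (Seq (add_ones 1 b 9 (lv d).+1)
    (Seq (countdown (lv d).+1 (lv d) (Seq (compile d.+1 e) (emit 0 [:: true; false])))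
         (clear (lv d))))
| FEx b e =>
  Seq (emit 0 (encode_formula falsum)) (Seq (add_ones 1 b 9 (lv d).+1)
    (Seq (countdown (lv d).+1 (lv d) (Seq (compile d.+1 e) (emit 0 [:: true; true])))
         (clear (lv d))))
| FBit r =>
  Seq (copy_word 3 11 9) (Seq (for_ones r 9 (Pop 11 Skip Skip Skip))
    (Seq emit_bit (clear 11)))
| FCnf r => Seq (copy_word 4 11 9) (Seq (parse_cnf r) (clear 11))
end.

(** The largest index is outermost because the loop runs upwards and puts each new instance in
    front. *)
Fixpoint big_formula (op : formula -> formula -> formula) idx n f :=
  if n is n'.+1 then op (f n') (big_formula op idx n' f) else idx.

Definition env_set (env : nat -> nat) r i := fun r' => if r' == r then i else env r'.

Definition code (env : nat -> nat) i j l := i * env 8 + j * env 7 + l.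

(** [env] records the numbers on the stacks. Stack 2 holds [t], which as second coordinate marks the
    variables of configurations. *)
Fixpoint denote n (phi : cnf n) cb d (env : nat -> nat) e : formula := match e with
| FVar i j l => Var (code env (env i) (env j) (env l))
| FNot e => Neg (denote phi cb d env e)
| FAnd e1 e2 => And (denote phi cb d env e1) (denote phi cb d env e2)
| FOr e1 e2 => Or (denote phi cb d env e1) (denote phi cb d env e2)
| FAll b e => big_formula And verum (env b)
                (fun i => denote phi cb d.+1 (env_set env (lv d) i) e)
| FEx b e => big_formula Or falsum (env b)
                (fun i => denote phi cb d.+1 (env_set env (lv d) i) e)
| FBit r => if nth false cb (env r) then verum else falsum
| FCnf r => cnf_formula (code env (env r) (env 2)) phi
end.

Fixpoint cost N e := match e with
| FVar i j l => cost_var N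
| FNot e => cost N e + 3
| FAnd e1 e2 | FOr e1 e2 => cost N e1 + cost N e2 + 3
| FAll b e | FEx b e => N * (cost N e) + N * 18 + 20
| FBit r => N * 19 + 30
| FCnf r => N * 10 + cost_cnf N + 10
end.

Record wf N n (phi : cnf n) cb d (env : nat -> nat) (m : store) : Prop := Wf {
  wf_ready : ready N (env 2) (env 7) (env 8) m;
  wf11 : m 11 = [::]; wf13 : m 13 = [::]; wf14 : m 14 = [::];
  wf_loops : forall r, lv d <= r -> m r = [::];
  wf_env : forall r, scoped d r -> m r = ones (env r) /\ env r <= N;
  wf_cb : m 3 = cb; wf_size_cb : size cb <= N;
  wf_phi : exists w, m 4 = encode_seq (encode_seq (@encode_literal n)) phi ++ w;
  wf_size_phi : size (m 4) <= N;
  wf_n : n <= N }.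

Lemma scoped_low d r : scoped d r -> low r.
Proof. by rewrite /scoped /low !inE; lia. Qed.

Lemma scopedS d r : scoped d.+1 r -> r = lv d \/ r <> lv d /\ r <> (lv d).+1 /\ scoped d r.
Proof.
rewrite /scoped /lv.
by case: (r \in _) / boolP => [|_ h]; rewrite ?inE; lia.
Qed.

Lemma wf_out N n (phi : cnf n) cb d env m u :
  wf N phi cb d env m -> wf N phi cb d env (update m 0 u).
Proof.
case=> -[*]; constructor; try by [].
- by move=> r lr; rewrite /update; case: eqP => [r0|_]; [rewrite r0 in lr | auto].
- move=> r lr; rewrite /update; case: eqP => [r0|_]; [by rewrite r0 in lr | auto].
Qed.

Lemma wf_loop N n (phi : cnf n) cb d env m u a i :
  wf N phi cb d env m -> i <= N ->
  wf N phi cb d.+1 (env_set env (lv d) i) (st (update m 0 u) (lv d).+1 (lv d) a i).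
Proof.
case=> -[m2 m7 m8 m9 m10 m12 m15 tN MN M2N m11 m13 m14 ml me m3 s3 [w m4] s4 nN] iN.
have E r : r <= 15 -> r <> 0 -> st (update m 0 u) (lv d).+1 (lv d) a i r = m r.
  by rewrite /lv => ? ?; upd.
have F r : r <= 15 -> env_set env (lv d) i r = env r.
  by rewrite /env_set /lv => ?; case: eqP => // ?; lia.
constructor=> //; try by rewrite E.
- move=> r; rewrite /lv => lr; have := ml r; rewrite /lv => H.
  by upd; apply: H; lia.
- move=> r /scopedS[->|[r1 [r2 sr]]].
    by rewrite /st /update eqxx /env_set eqxx.
  rewrite /st /update /env_set; case: eqP => // _; case: eqP => // _.
  case: eqP => [r0|_]; last exact: me.
  by rewrite r0 in sr.
- by exists w; rewrite E.
Qed.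

(** Serves both quantifiers: [op] and [idx] are [And] with [verum] or [Or] with [falsum], and [c] is
    the prefix tag of [op]. The iterations are counted on a copy of [b], so the bound survives even
    when it is an outer loop variable. *)
Lemma exec_loop N n (phi : cnf n) cb d env b body T op c idx f m :
  wf N phi cb d env m -> scoped d b ->
  (forall g h, encode_formula (op g h) = c ++ encode_formula g ++ encode_formula h) ->
  size c = 2 -> size (encode_formula idx) = 10 ->
  (forall i m', i <= N -> wf N phi cb d.+1 (env_set env (lv d) i) m' ->
     exec body m' (update m' 0 (encode_formula (f i) ++ m' 0)) T 0) ->
  exec (Seq (emit 0 (encode_formula idx)) (Seq (add_ones 1 b 9 (lv d).+1)
    (Seq (countdown (lv d).+1 (lv d) (Seq body (emit 0 c))) (clear (lv d))))) m
    (update m 0 (encode_formula (big_formula op idx (env b) f) ++ m 0))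
    (N * T + N * 18 + 20) 0.
Proof.
move=> wfm sb enc_op sc si bodyP.
have [mb bN] := wf_env wfm sb; have low_b := scoped_low sb.
have [[_ _ _ m9 _ _ _ _ _ _] _ _ _ ml _ _ _ _ _ _] := wfm.
have lvd : 20 <= lv d by rewrite /lv; lia.
have b09 : b <> 0 /\ b <> 9 by move: (low_free low_b); rewrite /free !inE; lia.
have blv : b < lv d.
  by case/orP: sb => [|/and3P[]//]; rewrite !inE => b5; apply: leq_trans lvd; lia.
have ml0 : m (lv d) = [::] by apply: ml.
have ml1 : m (lv d).+1 = [::] by apply: ml; lia.
apply: exec_conv.
- apply: exec_seq; first exact: exec_emit.
  apply: exec_seq.
    by apply: (exec_add_ones (n := env b) _ _ _ _ _);
      [apply/eqP; lia | apply/eqP; lia | apply/eqP; lia | upd | upd].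
  apply: exec_seq _ (exec_clear _ _).
  apply: exec_conv_eq (exec_countdown (n := env b) (T := T + 3) (Q := 0)
    (I := fun i => update m 0 (encode_formula (big_formula op idx i f) ++ m 0))
     _ _) _ erefl (leqnn _) (leqnn _).
  + by apply/eqP; lia.
  + move=> i lt_i; apply: exec_conv.
    * apply: exec_seq; last exact: exec_emit.
      by apply: bodyP; last (apply: wf_loop => //; lia); lia.
    * by rewrite /=; stores; rewrite enc_op -!catA.
    * by rewrite sc.
    * by [].
  + by stores; rewrite // muln1 ml1 cats0.
- by stores.
- rewrite si /st /update eqxx size_nseq; nia.
- by rewrite muln0.
Qed.

Lemma compileP N n (phi : cnf n) cb e d env m :
  well_scoped d e -> wf N phi cb d env m ->
  exec (compile d e) m
    (update m 0 (encode_formula (denote phi cb d env e) ++ m 0)) (cost N e) 0.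
Proof.
elim: e d env m => [i j l|e IH|e1 IH1 e2 IH2|e1 IH1 e2 IH2|b e IH|b e IH|r|r] d env m /=.
- move=> /and3P[si sj sl] wfm.
  have [[m2 m7 m8 m9 m10 m12 m15 tN MN M2N] _ _ _ _ me _ _ _ _ _] := wfm.
  have [mi iN] := me _ si; have [mj jN] := me _ sj; have [ml lN] := me _ sl.
  by apply: exec_emit_var => //; apply: low_free; apply: scoped_low; eassumption.
- move=> ce wfm; apply: exec_conv.
  + by apply: exec_seq; [exact: IH ce wfm | exact: exec_emit].
  + by stores.
  + by rewrite /=; lia.
  + by [].
- move=> /andP[c1 c2] wfm; apply: exec_conv.
  + apply: exec_seq; first exact: IH2 c2 wfm.
    by apply: exec_seq; [exact: IH1 c1 (wf_out _ wfm) | exact: exec_emit].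
  + by stores; rewrite //= -catA.
  + by rewrite /=; lia.
  + by [].
- move=> /andP[c1 c2] wfm; apply: exec_conv.
  + apply: exec_seq; first exact: IH2 c2 wfm.
    by apply: exec_seq; [exact: IH1 c1 (wf_out _ wfm) | exact: exec_emit].
  + by stores; rewrite //= -catA.
  + by rewrite /=; lia.
  + by [].
- move=> /andP[sb ce] wfm.
  apply: (exec_loop (idx := verum) (c := [:: true; false]) wfm sb) => //.
  by move=> i m' _; apply: IH.
- move=> /andP[sb ce] wfm.
  apply: (exec_loop (idx := falsum) (c := [:: true; true]) wfm sb) => //.
  by move=> i m' _; apply: IH.
- move=> sr wfm.
  have [[_ _ _ m9 _ _ _ _ _ _] m11 _ _ _ me m3 s3 _ _ _] := wfm.
  have [mr rN] := me _ sr.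
  have := low_free (scoped_low sr); have [r11 _ _ _ _] := low_neq (scoped_low sr).
  rewrite /free !inE !negb_or => /and5P[r0 _ _ r9 _].
  apply: exec_conv.
  + apply: exec_seq; first exact: exec_copy_word.
    apply: exec_seq.
      by apply: (exec_drop (n := env r)); rewrite //; upd.
    apply: exec_seq _ (exec_clear _ _).
    by apply: (exec_emit_bit (i := env r) (cb := cb)); rewrite /update /= m3 m11 cats0.
  + by stores.
  + rewrite m3 /update /= size_drop; lia.
  + by [].
- move=> sr wfm.
  have [rd m11 m13 m14 _ me _ _ [w m4] s4 nN] := wfm.
  have [mr rN] := me _ sr; have lr := scoped_low sr.
  have [r11 _ _ _ _] := low_neq lr.
  have m9 := ready9 rd.
  apply: exec_conv.
  + apply: exec_seq; first exact: exec_copy_word.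
    apply: exec_seq.
      apply: (exec_parse_cnf (N := N) (phi := phi) (w := w) (c := env r) (t := env 2)
        (M := env 7) (M2 := env 8)); rewrite //; try by upd.
      * by case: rd => *; constructor.
      * by apply: leq_trans s4; rewrite m4 size_cat leq_addr.
      * by rewrite /update /= m11 cats0.
    exact: exec_clear.
  + by stores.
  + rewrite /update /=.
    have : size w <= N by apply: leq_trans s4; rewrite m4 size_cat leq_addl.
    by move: s4; lia.
  + by [].
Qed.

(** * Coverage as counting of tuples *)

Section Tuples.

Context (n t : nat) (phi : cnf n) (C : {set 'I_n}).

Notation tuples := {ffun 'I_t -> literal n}.

(** Ordering the literals counts an interaction several times, which is harmless as only equality of
    counts matters. Distinct features rule out repeated literals, which would give smaller sets, and
    complementary pairs, which no configuration satisfies. *)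
Definition admissible (tau : tuples) :=
  [forall d, (tau d).1 \in C] && [forall d, forall e, ((tau d).1 == (tau e).1) ==> (d == e)].

Definition satisfies (a : assignment n) (tau : tuples) :=
  [forall d, a (tau d).1 == (tau d).2].

Definition covered (S : {set assignment n}) : {set tuples} :=
  [set tau | admissible tau && [exists a in S, satisfies a tau]].

Definition feasible_tuples := covered [set a | valid phi a].

Definition coverable s k := exists S : {set assignment n},
  [/\ sample phi S, #|S| <= s & k <= #|covered S|].

Lemma covered_feasible S : sample phi S -> covered S \subset feasible_tuples.
Proof.
move=> vS; apply/subsetP=> tau; rewrite !inE => /andP[-> /existsP[a /andP[aS sa]]].
by apply/existsP; exists a; rewrite inE vS.
Qed.

Lemma isp_decisionP s :
  isp_decision t (IspInstance phi C s) <->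
  exists S, [/\ sample phi S, feasible_tuples \subset covered S & #|S| <= s].
Proof.
split=> -[S /= [vS cS Ss]]; exists S; split=> //.
- apply/subsetP=> tau; rewrite !inE => /andP[/andP[/forallP tC /forallP tI]].
  case/existsP=> a; rewrite inE => /andP[va /forallP sa].
  rewrite {1}/admissible; apply/andP; split.
    by apply/andP; split; apply/forallP.
  have injt : injective tau.
    move=> d e de; have /forallP/(_ e)/implyP := tI d.
    by rewrite de => /(_ (eqxx _))/eqP.
  have [||b [bS cb]] := cS [set tau d | d in 'I_t].
  + split; last by rewrite card_imset ?card_ord.
    by apply/subsetP=> l /imsetP[d _ ->]; rewrite inE.
  + exists a; split=> //; apply/subsetP=> l /imsetP[d _ ->].
    by rewrite inE sa.
  apply/existsP; exists b; rewrite bS; apply/forallP=> d.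
  have /subsetP/(_ (tau d)) := cb; rewrite inE; apply.
  by apply/imsetP; exists d.
- move=> I [IC It] [a [va /subsetP ca]].
  have castI (d : 'I_t) : d < #|I| by rewrite It.
  pose f (d : 'I_t) : 'I_#|I| := Ordinal (castI d).
  pose tau : tuples := [ffun d => enum_val (f d)].
  have tauI d : tau d \in I by rewrite ffunE enum_valP.
  have sat_tau d : a (tau d).1 = (tau d).2 by apply/eqP; have := ca _ (tauI d); rewrite inE.
  have /(subsetP cS) : tau \in feasible_tuples.
    rewrite inE; apply/andP; split; last first.
      by apply/existsP; exists a; rewrite inE va; apply/forallP=> d; rewrite sat_tau.
    apply/andP; split; apply/forallP=> d.
      by have := subsetP IC _ (tauI d); rewrite inE.
    apply/forallP=> e; apply/implyP=> /eqP de.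
    (* Both literals are true under [a], so equal features have equal signs. *)
    have : tau d = tau e.
      by rewrite [LHS]surjective_pairing [RHS]surjective_pairing -!sat_tau de.
    by rewrite !ffunE => /enum_val_inj[] /eqP; rewrite -val_eqE.
  rewrite inE => /andP[_ /existsP[b /andP[bS /forallP sb]]].
  exists b; split=> //; apply/subsetP=> l lI.
  have lt : enum_rank_in lI l < t by rewrite -[X in _ < X]It.
  have := sb (Ordinal lt); rewrite ffunE inE.
  suff -> : enum_val (f (Ordinal lt)) = l by [].
  rewrite -[RHS](enum_rankK_in lI lI); congr enum_val; exact: val_inj.
Qed.

Lemma card_feasible_tuples : #|feasible_tuples| <= (#|C| * 2) ^ t.
Proof.
have cardD : #|[set l : literal n | l.1 \in C]| = #|C| * 2.
  rewrite -card_bool -cardsT -cardsX; apply: eq_card => l.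
  by rewrite !inE andbT.
rewrite -cardD -[X in _ ^ X]card_ord -card_ffun_on; apply: subset_leq_card.
apply/subsetP=> tau; rewrite inE => /andP[/andP[/forallP tC _] _].
by apply/ffun_onP=> d; rewrite inE.
Qed.

Lemma small_cover : exists S,
  [/\ sample phi S, feasible_tuples \subset covered S & #|S| <= #|feasible_tuples|].
Proof.
(* One witness per feasible tuple; the all-false default is never reached for these. *)
pose w (tau : tuples) : assignment n :=
  odflt [ffun=> false] [pick a | valid phi a && satisfies a tau].
have wP tau : tau \in feasible_tuples -> valid phi (w tau) && satisfies (w tau) tau.
  rewrite inE => /andP[_ /existsP[a]]; rewrite inE => va.
  by rewrite /w; case: pickP => //= /(_ a); rewrite va.
exists [set w tau | tau in feasible_tuples]; split.
- by move=> a /imsetP[tau /wP/andP[va _] ->].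
- apply/subsetP=> tau ft; have := ft; rewrite !inE => /andP[-> _] /=.
  apply/existsP; exists (w tau); have /andP[_ ->] := wP _ ft.
  by rewrite andbT; apply/imsetP; exists tau.
- exact: leq_imset_card.
Qed.

(** With room for a full cover, [coverable] becomes a threshold property of [k], which is what
    binary search needs. *)
Lemma coverable_max N k : #|feasible_tuples| <= N ->
  coverable N k <-> k <= #|feasible_tuples|.
Proof.
move=> fN; split=> [[S [vS _ kS]]|kf].
  by apply: leq_trans kS _; apply/subset_leq_card/covered_feasible.
have [S [vS cS Sf]] := small_cover; exists S; split=> //.
  exact: leq_trans fN.
by apply: leq_trans kf _; apply: subset_leq_card.
Qed.

Lemma coverable_decision N s : #|feasible_tuples| <= N ->
  coverable (minn s N) #|feasible_tuples| <-> isp_decision t (IspInstance phi C s).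
Proof.
move=> fN; rewrite isp_decisionP; split=> -[S [vS cS Sf]].
  exists S; split=> //; last by lia.
  (* A subset of the feasible tuples with at least as many elements is all of them. *)
  by have := geq_leqif (subset_leqif_cards (covered_feasible vS)); rewrite Sf => /esym/eqP ->.
have [S' [vS' cS' Sf']] := small_cover.
(* A sample too large for the clamped bound is exchanged for the small cover. *)
case: (leqP #|S| N) => SN; [exists S | exists S']; split=> //; try lia;
  exact: subset_leq_card.
Qed.

End Tuples.

(** * The query formula *)

Definition FIff a b := FOr (FAnd a b) (FAnd (FNot a) (FNot b)).

(* Tokens are on loop level 0.  With [z p d x] for the variable [(p, d, x)],
   token [p < k] stands for the tuple whose [d]-th feature is the only [x < n]
   with [z p d x] and whose [d]-th sign is [z p d n]; configuration [c] gives
   [x] the value [z c t x]. *)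
Definition query : fexp :=
  FAll 6 (FAnd
    (FEx 5 (FAnd (FCnf 22)
      (FAll 2 (FEx 1 (FAnd (FVar 20 24 26) (FAnd (FBit 26)
        (FIff (FVar 20 24 1) (FVar 22 2 26))))))))
    (FAnd
      (FAll 2 (FAll 1 (FAnd
        (FAll 24 (FNot (FAnd (FVar 20 22 24) (FVar 20 22 26))))
        (FAll 22 (FNot (FAnd (FVar 20 22 24) (FVar 20 26 24)))))))
      (FAll 20 (FEx 2 (FOr
        (FNot (FIff (FVar 20 24 1) (FVar 22 24 1)))
        (FEx 1 (FNot (FIff (FVar 20 24 26) (FVar 22 24 26))))))))).

(** Written exactly as [meaning] interprets [FIff], which makes the meaning of [query] convertible
    to [tokens]. *)
Definition agree (a b : bool) : Prop := (a /\ b) \/ (~ a /\ ~ b).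

Lemma agreeE a b : agree a b <-> a = b.
Proof.
rewrite /agree; case: a; case: b; split=> //;
  by [left | case=> -[] | case=> -[] | right].
Qed.

Fixpoint meaning n (phi : cnf n) cb (z : nat -> nat -> nat -> bool) d
    (env : nat -> nat) e : Prop := match e with
| FVar i j l => z (env i) (env j) (env l)
| FNot e => ~ meaning phi cb z d env e
| FAnd e1 e2 => meaning phi cb z d env e1 /\ meaning phi cb z d env e2
| FOr e1 e2 => meaning phi cb z d env e1 \/ meaning phi cb z d env e2
| FAll b e => forall i, i < env b -> meaning phi cb z d.+1 (env_set env (lv d) i) e
| FEx b e => exists2 i, i < env b & meaning phi cb z d.+1 (env_set env (lv d) i) e
| FBit r => nth false cb (env r)
| FCnf r => all (has (fun l : literal n => z (env r) (env 2) l.1 == l.2)) phi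
end.

(** Uniqueness and distinctness compare only with smaller indices: loop bounds may be outer loop
    variables, so these ranges are available, and the other order follows by symmetry. *)
Definition tokens n (phi : cnf n) cb m t s k (z : nat -> nat -> nat -> bool) : Prop :=
  forall p, p < k ->
    (exists2 c, c < s &
       all (has (fun l : literal n => z c t l.1 == l.2)) phi /\
       forall d, d < t -> exists2 x, x < m &
         z p d x /\ nth false cb x /\ agree (z p d m) (z c t x)) /\
    (forall d, d < t -> forall x, x < m ->
       (forall y, y < x -> ~ (z p d x /\ z p d y)) /\
       (forall e, e < d -> ~ (z p d x /\ z p e x))) /\
    (forall q, q < p -> exists2 d, d < t &
       ~ agree (z p d m) (z q d m) \/
       exists2 x, x < m & ~ agree (z p d x) (z q d x)).

Lemma eval_big_and v n f :
  eval v (big_formula And verum n f) <-> forall i, i < n -> eval v (f i).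
Proof.
elim: n => [|n IH] /=; first by rewrite orbN.
split=> [/andP[fn /IH fl] i|fl].
  by rewrite ltnS leq_eqVlt => /orP[/eqP->|/fl].
by rewrite fl //=; apply/IH => i lt_i; apply: fl; lia.
Qed.

Lemma eval_big_or v n f :
  eval v (big_formula Or falsum n f) <-> exists2 i, i < n & eval v (f i).
Proof.
elim: n => [|n IH] /=; first by rewrite andbN; split=> // -[].
split=> [/orP[fn|/IH[i lt_i fi]]|[i]]; first by exists n.
  by exists i => //; lia.
rewrite ltnS leq_eqVlt => /orP[/eqP->->//|lt_i fi].
by apply/orP; right; apply/IH; exists i.
Qed.

Lemma eval_denote v n (phi : cnf n) cb d env M M2 e :
  well_scoped d e -> env 7 = M -> env 8 = M2 ->
  eval v (denote phi cb d env e) <->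
  meaning phi cb (fun i j l => v (i * M2 + j * M + l)) d env e.
Proof.
move=> + E7 E8; elim: e d env E7 E8 =>
  [i j l|e IH|e1 IH1 e2 IH2|e1 IH1 e2 IH2|b e IH|b e IH|r|r] d env E7 E8 /=.
- by rewrite /code E7 E8.
- by move=> ce; rewrite -(IH d env E7 E8 ce); split=> /negP.
- by case/andP=> c1 c2; rewrite -(IH1 d env) // -(IH2 d env) //; split=> /andP.
- by case/andP=> c1 c2; rewrite -(IH1 d env) // -(IH2 d env) //; split=> /orP.
- case/andP=> _ ce; rewrite eval_big_and.
  by split=> H i /H; rewrite -IH.
- case/andP=> _ ce; rewrite eval_big_or.
  by split=> -[i lt_i H]; exists i => //; move: H; rewrite -IH.
- by move=> _; case: (nth _ _ _); rewrite /= ?orbN ?andbN.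
- by move=> _; rewrite eval_cnf_formula /code E7 E8.
Qed.

Lemma eval_query v n (phi : cnf n) cb env :
  eval v (denote phi cb 0 env query) <->
  tokens phi cb (env 1) (env 2) (env 5) (env 6)
    (fun i j l => v (i * env 8 + j * env 7 + l)).
Proof.
exact: (@eval_denote v n phi cb 0 env (env 7) (env 8) query erefl erefl erefl).
Qed.

(** * Satisfying assignments versus covered tuples *)

Definition concrete_bits n (C : {set 'I_n}) := [seq i \in C | i <- enum 'I_n].

Lemma size_concrete_bits n (C : {set 'I_n}) : size (concrete_bits C) = n.
Proof. by rewrite size_map size_enum_ord. Qed.

Lemma count_concrete_bits n (C : {set 'I_n}) :
  count_mem true (concrete_bits C) = #|C|.
Proof.
rewrite count_map cardE -size_filter; congr size.
by rewrite enumT; apply: eq_filter => i /=; rewrite eqb_id.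
Qed.

Section Tokens.

Context (n t s k : nat) (phi : cnf n) (C : {set 'I_n}).

Lemma nth_concrete (x : 'I_n) : nth false (concrete_bits C) x = (x \in C).
Proof. by rewrite (nth_map x) ?size_enum_ord // nth_ord_enum. Qed.

Lemma tokens_coverable z : tokens phi (concrete_bits C) n t s k z -> coverable t phi C s k.
Proof.
move=> tokz.
pose cfg (c : 'I_s) : assignment n := [ffun x : 'I_n => z c t x].
pose reads (p : 'I_k) (tau : {ffun 'I_t -> literal n}) :=
  forall d : 'I_t, z p d (tau d).1 /\ (tau d).2 = z p d n.
have tokP p : exists tau, [/\ reads p tau, admissible C tau &
    exists2 c, valid phi (cfg c) & satisfies (cfg c) tau].
  have [[c lt_c [vc ex]] [uniqp _]] := tokz p (ltn_ord p).
  have /fin_all_exists[f fP] (d : 'I_t) : exists x : 'I_n,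
      [/\ z p d x, x \in C & z p d n = z c t x].
    have [x lt_x [zx [cx /agreeE sx]]] := ex d (ltn_ord d).
    by exists (Ordinal lt_x); rewrite -nth_concrete.
  exists [ffun d => (f d, z p d n)]; split.
  - by move=> d; rewrite ffunE; have [] := fP d.
  - apply/andP; split; apply/forallP=> d; first by rewrite ffunE; have [] := fP d.
    apply/forallP=> e; rewrite !ffunE /=; apply/implyP=> /eqP de.
    have [zd _ _] := fP d; have [ze _ _] := fP e; rewrite de in zd.
    rewrite -val_eqE; case: ltngtP => // lt_de.
      by have [_ /(_ d lt_de)[]] := uniqp e (ltn_ord e) (f e) (ltn_ord _).
    by have [_ /(_ e lt_de)[]] := uniqp d (ltn_ord d) (f e) (ltn_ord _).
  - exists (Ordinal lt_c).
      apply: etrans vc; apply: eq_all => cl; apply: eq_has => l.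
      by rewrite inE ffunE.
    by apply/forallP=> d; rewrite !ffunE; have [_ _ ->] := fP d.
have [tau tauP] := fin_all_exists tokP.
(* Configurations that no token uses need not satisfy the model, hence the filter. *)
exists [set cfg c | c in 'I_s & valid phi (cfg c)]; split.
- by move=> a /imsetP[c]; rewrite inE => /andP[_ vc] ->.
- apply: leq_trans (leq_imset_card _ _) _; rewrite -[X in _ <= X]card_ord.
  exact: max_card.
have inj_tau : injective tau.
  have lt_neq (p q : 'I_k) : q < p -> tau p <> tau q.
    move=> lt_qp eq_pq; have [_ [uniqp dist]] := tokz p (ltn_ord p).
    have [d lt_d diff] := dist q lt_qp.
    have [rp _ _] := tauP p; have [rq _ _] := tauP q.
    have [zp sp] := rp (Ordinal lt_d); have [zq sq] := rq (Ordinal lt_d).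
    rewrite /= -eq_pq in zp sp zq sq.
    case: diff => [|[x lt_x]]; apply; apply/agreeE; first by rewrite -sp.
    (* A token marks exactly one feature per position, so tokens with equal tuples agree on every
       feature variable. *)
    have only (r : 'I_k) : z r d (tau p (Ordinal lt_d)).1 ->
        z r d x = (x == (tau p (Ordinal lt_d)).1).
      set y := (tau p _).1 => zy; have [_ [uniqr _]] := tokz r (ltn_ord r).
      case: ltngtP => [lt_xy|lt_yx|->] //; apply/negP=> zx.
        by have [/(_ x lt_xy)[]] := uniqr d lt_d y (ltn_ord _).
      by have [/(_ y lt_yx)[]] := uniqr d lt_d x lt_x.
    by rewrite !only.
  move=> p q eq_pq; apply: val_inj; case: (ltngtP p q) => // lt_pq.
    by case: (lt_neq _ _ lt_pq).
  by case: (lt_neq _ _ lt_pq).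
rewrite -[k]card_ord -(card_imset _ inj_tau); apply/subset_leq_card/subsetP.
move=> _ /imsetP[p _ ->]; have [_ adm [c vc sc]] := tauP p.
rewrite inE adm; apply/existsP; exists (cfg c); rewrite sc andbT.
by apply/imsetP; exists c; rewrite // inE.
Qed.

Lemma coverable_tokens M : t < M -> n < M -> coverable t phi C s k ->
  exists v, tokens phi (concrete_bits C) n t s k (fun i j l => v (i * (M * M) + j * M + l)).
Proof.
move=> tM nM [S [vS Ss kS]].
(* For [k > 0] some tuple is covered and can serve as the default of [nth]. *)
case: (posnP k) => [->|k_gt0]; first by exists xpredT.
have [tau0 _] : exists tau, tau \in covered t C S by apply/card_gt0P; lia.
pose tau p := nth tau0 (enum (covered t C S)) p.
pose cfg c := nth [ffun=> false] (enum S) c.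
(* Second coordinates below [t] belong to tokens, with the sign at [l = n]; all others belong to
   configurations. *)
pose w i j l := if insub j is Some d then
    (if l == n then (tau i d).2 else (tau i d).1 == l :> nat)
  else if insub l is Some x then cfg i x else false.
(* Inverse of the numbering: the last two coordinates are digits in base [M], the first is what
   remains. *)
pose v x := w (x %/ M %/ M) (x %/ M %% M) (x %% M).
have vE i j l : j < M -> l < M -> v (i * (M * M) + j * M + l) = w i j l.
  move=> jM lM; have M_gt0 : 0 < M by lia.
  have -> : i * (M * M) + j * M + l = (i * M + j) * M + l by lia.
  by rewrite /v divnMDl // modnMDl (divn_small lM) (modn_small lM) addn0
    divnMDl // modnMDl (divn_small jM) (modn_small jM) addn0.
exists v; set z := fun i j l => _.
have zs p (d : 'I_t) : z p d n = (tau p d).2.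
  by rewrite /z vE //; [rewrite /w valK eqxx | have := ltn_ord d; lia].
have zf p (d : 'I_t) (x : 'I_n) : z p d x = ((tau p d).1 == x).
  rewrite /z vE; [|have := ltn_ord d; lia|have := ltn_ord x; lia].
  by rewrite /w valK; case: eqP => // E; have := ltn_ord x; lia.
have zc c (x : 'I_n) : z c t x = cfg c x.
  rewrite /z vE //; last by have := ltn_ord x; lia.
  by rewrite /w insubN ?ltnn // valK.
move=> p lt_pk.
have lt_p : p < size (enum (covered t C S)) by rewrite -cardE; lia.
have := mem_nth tau0 lt_p; rewrite mem_enum -/(tau p) inE.
case/andP=> /andP[/forallP inC /forallP inj] /existsP[a /andP[aS /forallP sa]].
split; last split.
- have idx : index a (enum S) < size (enum S) by rewrite index_mem mem_enum.
  have cfgE : cfg (index a (enum S)) = a by rewrite /cfg nth_index ?mem_enum.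
  exists (index a (enum S)); first by apply: leq_trans idx _; rewrite -cardE.
  split.
    have va := vS a aS.
    apply: etrans va; apply: eq_all => cl; apply: eq_has => l.
    by rewrite inE zc cfgE.
  move=> d0 lt_d; pose d := Ordinal lt_d; exists (tau p d).1; first exact: ltn_ord.
  rewrite -[d0]/(val d) zf eqxx nth_concrete; split=> //; split; first exact: inC.
  by apply/agreeE; rewrite zs zc cfgE; apply/esym/eqP/sa.
- move=> d0 lt_d x0 lt_x; pose d := Ordinal lt_d; pose x := Ordinal lt_x.
  rewrite -[d0]/(val d) -[x0]/(val x); split=> y0 lt_y.
    have lt_yn : y0 < n by apply: ltn_trans lt_y _.
    rewrite -[y0]/(val (Ordinal lt_yn)) !zf => -[/eqP E1 /eqP E2].
    by rewrite E1 in E2; rewrite E2 ltnn in lt_y.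
  have lt_yt : y0 < t by apply: ltn_trans lt_y _.
  rewrite -[y0]/(val (Ordinal lt_yt)) !zf => -[/eqP E1 /eqP E2].
  have /forallP/(_ (Ordinal lt_yt)) := inj d.
  by rewrite E1 E2 eqxx => /eqP E; rewrite E ltnn in lt_y.
- move=> q lt_qp.
  have neq : tau p != tau q.
    rewrite nth_uniq ?enum_uniq //; last by apply: ltn_trans lt_p.
    by rewrite gtn_eqF.
  have [d Hd] : exists d, tau p d != tau q d.
    apply/existsP; rewrite -negb_forall; apply: contra neq => /forallP eq.
    by apply/eqP/ffunP=> d; apply/eqP.
  exists d; first exact: ltn_ord.
  rewrite agreeE !zs; case: (eqVneq (tau p d).2 (tau q d).2) => [E|/eqP]; last by left.
  right; exists (tau p d).1; first exact: ltn_ord.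
  rewrite agreeE !zf eqxx => /esym/eqP E'.
  by move: Hd; rewrite [tau p d]surjective_pairing [tau q d]surjective_pairing E E' eqxx.
Qed.

End Tokens.

Lemma sat_query n (phi : cnf n) (C : {set 'I_n}) env :
  env 1 = n -> env 2 < env 7 -> n < env 7 -> env 8 = env 7 * env 7 ->
  SAT (encode_formula (denote phi (concrete_bits C) 0 env query)) <->
  coverable (env 2) phi C (env 5) (env 6).
Proof.
move=> env1 tM nM env8; split=> [[f [/encode_formula_inj <- [v]]]|].
  by rewrite eval_query env1 => /tokens_coverable.
move/(coverable_tokens tM nM) => [v tok]; eexists; split; first by [].
by exists v; apply/eval_query; rewrite env1 env8.
Qed.

(** * Reading the instance *)

(* The stacks: 0 the input, later the formula and the answer; 1 [n], 2 [t],
   3 the concrete bits, 4 the clauses followed by the bound, 5 and 6 the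
   parameters [s] and [k] of a query, 7 [n + t + 1] and 8 its square, 11 the
   clauses being parsed, 16 [|C|] and then the clamped bound, 17 [K], 18 the
   width of the search interval, 19 half of it.  Numbers are in unary, and the
   omitted stacks are empty. *)
Definition memory (w0 w1 w2 w3 w4 w5 w6 w7 w8 w11 w16 w17 w18 w19 : seq bool) : store :=
  nth [::] [:: w0; w1; w2; w3; w4; w5; w6; w7; w8; [::]; [::]; w11;
               [::]; [::]; [::]; [::]; w16; w17; w18; w19].

Ltac memories_from r k := lazymatch k with
  | 0 => first [done | by rewrite /st /update /= ?nth_nil]
  | S ?k' => destruct r as [|r]; [rewrite /st /update /=; try done | memories_from r k']
  end.

Ltac memories := apply: functional_extensionality; rewrite /memory;
  let r := fresh "r" in move=> r; memories_from r 20.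

(** [move_word] reverses: the bits were stacked backwards on 10 and come out in order on 3, while
    the rest of the input needs two moves to reach 4 unreversed. *)
Definition read_features := Seq (read_ones 0 13 1)
  (Seq (for_ones 1 9 (Pop 0 Skip (Push 10 false) (Seq (Push 10 true) (Push 16 true))))
  (Seq (move_word 10 3) (Seq (move_word 0 10) (move_word 10 4)))).

Lemma exec_read_features n bs w :
  size bs = n ->
  exec read_features
    (memory (encode_unary n ++ bs ++ w) [::] [::] [::] [::] [::] [::] [::] [::]
       [::] [::] [::] [::] [::])
    (memory [::] (ones n) [::] bs w [::] [::] [::] [::]
       [::] (ones (count_mem true bs)) [::] [::] [::])
    (n * 20 + size w * 6 + 20) 0.
Proof.
move=> size_bs; apply: exec_conv.
- apply: exec_seq; first by apply: (exec_read_ones (x := n) (w := bs ++ w)).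
  pose I i := update (update (update (memory [::] [::] [::] [::] [::] [::] [::] [::]
     [::] [::] [::] [::] [::] [::]) 0 (drop i bs ++ w)) 10 (rev (take i bs)))
     16 (ones (count_mem true (take i bs))).
  apply: (exec_seq (m1 := st (I n) 1 9 n 0)); last first.
    apply: (exec_seq_eq (m1' := memory w (ones n) [::] bs [::] [::] [::] [::] [::] [::]
      (ones (count_mem true bs)) [::] [::] [::])); first exact: exec_move_word.
      by rewrite /I -size_bs take_size drop_size; memories; rewrite // cats0 revK.
    by apply: exec_seq; exact: exec_move_word.
  + apply: (exec_for_ones (n := n) (T := 3) (Q := 0) (I := I) _ _ erefl) => //.
      by rewrite /I drop0 take0 /=; memories; rewrite // cats0.
    move=> i lt_i; rewrite -size_bs in lt_i; rewrite /I.
    rewrite (drop_nth false lt_i) (take_nth false lt_i) rev_rcons -cats1 count_cat /=.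
    apply: (exec_pop (b := nth false bs i)); first by [].
    case: (nth _ _ _); rewrite /= ?addn0 ?addn1.
      by apply: exec_conv; [apply: exec_seq; exact: exec_push | memories | |].
    by apply: exec_conv; [exact: exec_push | memories | |].
- by memories; rewrite // !cats0 revK.
- rewrite /update /memory /= size_cat !size_rev /update /I /memory /= -size_bs size_take ltnn; lia.
- by rewrite muln0.
Qed.

(** As [t] is fixed, the exponentiation is unrolled into the program, one multiplication by twice
    the number on stack 16 per level. *)
Fixpoint power_program j : program :=
  if j is j'.+1 then
    Seq (power_program j')
        (Seq (mul_ones 2 17 9 16 10 18) (Seq (clear 17) (move_word 18 17)))
  else Push 17 true.

Lemma exec_power_program N c w1 w2 w3 w4 j :
  c <= N -> (forall i, i <= j -> (c * 2) ^ i <= N) ->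
  exec (power_program j)
    (memory [::] w1 w2 w3 w4 [::] [::] [::] [::] [::] (ones c) [::] [::] [::])
    (memory [::] w1 w2 w3 w4 [::] [::] [::] [::] [::] (ones c) (ones ((c * 2) ^ j)) [::] [::])
    (1 + j * (N * (N * 10 + 9) + N * 6 + 4)) 0.
Proof.
move=> cN; elim: j => [|j IH] leN.
  by apply: exec_conv; [exact: exec_push | memories | |].
have K1 := leN j.+1 (leqnn _); have K0 := leN j (leqnSn _).
apply: exec_conv.
- apply: exec_seq; first by apply: IH => i ij; apply: leN; lia.
  apply: exec_seq.
    by apply: (exec_mul_ones (n := (c * 2) ^ j) (n' := c) _ _ _ _ _).
  by apply: exec_seq; [exact: exec_clear | exact: exec_move_word].
- memories; rewrite /update /memory /= !cats0 /ones rev_nseq expnS mulnC //.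
- rewrite /update /memory /= !size_cat !size_nseq.
  by move: K1 K0; rewrite expnS /=; nia.
- by [].
Qed.

(** The factors of a product must lie on different stacks, hence the temporary copy on 18. *)
Definition set_sizes := Seq (add_ones 1 1 9 7) (Seq (add_ones 1 2 9 7)
  (Seq (Push 7 true) (Seq (add_ones 1 7 9 18) (Seq (mul_ones 1 7 9 18 10 8)
  (clear 18))))).

Lemma exec_set_sizes N n t w3 w4 w16 w17 :
  n + t + 1 <= N ->
  exec set_sizes
    (memory [::] (ones n) (ones t) w3 w4 [::] [::] [::] [::] [::] w16 w17 [::] [::])
    (memory [::] (ones n) (ones t) w3 w4 [::] [::] (ones (n + t).+1)
       (ones ((n + t).+1 * (n + t).+1)) [::] w16 w17 [::] [::])
    (N * (N * 9 + 9) + N * 30 + 20) 0.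
Proof.
move=> leN; apply: exec_conv.
- apply: exec_seq; first by apply: (exec_add_ones (n := n) _ _ _ _ _).
  apply: exec_seq; first by apply: (exec_add_ones (n := t) _ _ _ _ _).
  apply: exec_seq; first exact: exec_push.
  apply: exec_seq.
    apply: (exec_add_ones (n := (n + t).+1) _ _ _ _ _) => //.
    by rewrite /update /memory /= !muln1 cats0 /ones -nseqD addnC.
  apply: exec_seq.
    apply: (exec_mul_ones (n := (n + t).+1) (n' := (n + t).+1) _ _ _ _ _) => //.
      by rewrite /update /memory /= !muln1 cats0 /ones -nseqD addnC.
    by rewrite /update /memory /= !muln1 cats0.
  exact: exec_clear.
- by memories; rewrite /update /memory /= !muln1 cats0 // /ones -nseqD addnC.
- rewrite /update /memory /= !muln1 cats0 size_nseq; nia.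
- by [].
Qed.

(** The bound lies behind the clauses, which are skipped by parsing them and discarding the formula
    produced; the empty stack 20 acts as the number 0. The digits end up on 19 with the most
    significant on top. *)
Definition read_bound := Seq (copy_word 4 11 9) (Seq (parse_cnf 20) (Seq (clear 0)
  (readseq 11 13 (Pop 11 Skip (Push 19 false) (Push 19 true))))).

(** One step adds at most one bit to a stack. This bounds the discarded formula, hence the time to
    clear it. *)
Lemma exec_size T Q p m m' r : exec p m m' T Q -> size (m' r) <= size (m r) + T.
Proof.
case=> i [j [R iT _]]; apply: leq_trans (_ : size (m r) + i <= _); last by rewrite leq_add2l.
elim: R {iT} => {p m m' i j} //=.
- by move=> m; lia.
- by move=> m r' b; rewrite /update; case: eqP => [->|_] /=; lia.
- by move=> m r' pe pf pt m' i q _ _; lia.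
- by move=> m r' w pe pf pt m' i q E _; rewrite /update; case: eqP => [->|_]; rewrite ?E /=; lia.
- by move=> m r' w pe pf pt m' i q E _; rewrite /update; case: eqP => [->|_]; rewrite ?E /=; lia.
- by move=> *; lia.
- by move=> *; lia.
- by move=> *; lia.
- by move=> m r' _; rewrite /update; case: eqP => _ /=; lia.
- by move=> m r' _; rewrite /update; case: eqP => _ /=; lia.
Qed.

Notation encode_cnf phi := (encode_seq (encode_seq (@encode_literal _)) phi).
Notation encode_bits bs := (encode_seq (fun b : bool => [:: b]) bs).

Lemma exec_read_bound N n t M M2 (phi : cnf n) bs w1 w3 w16 w17 :
  n <= N -> t <= N -> M <= N -> M2 <= N ->
  size (encode_cnf phi ++ encode_bits bs) <= N ->
  exec read_bound
    (memory [::] w1 (ones t) w3 (encode_cnf phi ++ encode_bits bs) [::] [::]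
       (ones M) (ones M2) [::] w16 w17 [::] [::])
    (memory [::] w1 (ones t) w3 (encode_cnf phi ++ encode_bits bs) [::] [::]
       (ones M) (ones M2) [::] w16 w17 [::] (rev bs))
    (N * 11 + cost_cnf N * 4 + 20) 0.
Proof.
move=> nN tN MN M2N; rewrite size_cat => sN.
set m := memory _ _ _ _ _ _ _ _ _ _ _ _ _ _.
set m1 := update m 11 (m 4 ++ m 11).
have R : exec (parse_cnf 20) m1
    (update (update m1 11 (encode_bits bs)) 0 (encode_formula
       (cnf_formula (fun x => 0 * M2 + t * M + x) phi) ++ m1 0)) (cost_cnf N) 0.
  apply: (exec_parse_cnf (N := N) (c := 0) (t := t) (M := M) (M2 := M2)
    (phi := phi) (w := encode_bits bs)) => //.
  - exact: leq_trans (leq_addr _ _) sN.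
  - by rewrite /m1 /update /= cats0.
have := exec_size 0 R; rewrite [size (m1 0)]/= add0n => sR.
apply: exec_conv.
- apply: exec_seq; first exact: exec_copy_word.
  apply: exec_seq; first exact: R.
  apply: exec_seq; first exact: exec_clear.
  apply: (exec_readseq (e := fun b => [:: b]) (s := bs) (w := [::]) (T := 2) (Q := 0)
    (I := fun p => update m 19 (rev p)) _ _ erefl) => //.
    by rewrite cats0; memories.
  move=> pre b post _; apply: (exec_pop (b := b) (w := encode_bits post)).
    by rewrite /update /= cats0.
  rewrite cats0 rev_rcons.
  by case: b; (apply: exec_conv; [exact: exec_push | memories | | ]).
- by memories.
- have := size_encode_seq (fun b => [:: b]) bs.
  by rewrite {1}/m /memory /= size_cat; lia.
- by rewrite muln0.
Qed.

(** One Horner step on the binary digits, cut off at [K] at once: the full value may be exponential,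
    but no number written in unary exceeds [2 * K + 1]. *)
Definition clamp_step (b : bool) := Seq (add_ones 2 16 9 18)
  (Seq (emit 18 (ones b)) (Seq (clear 16)
  (Seq (for_ones 17 9 (Pop 18 Skip Skip (Push 16 true))) (clear 18)))).

Definition clamp_bound :=
  Seq (clear 16) (While 19 (Pop 19 Skip (clamp_step false) (clamp_step true))).

Lemma exec_clamp_step N K w1 w2 w3 w4 w7 w8 w19 s b :
  s <= N -> K <= N ->
  exec (clamp_step b)
    (memory [::] w1 w2 w3 w4 [::] [::] w7 w8 [::] (ones s) (ones K) [::] w19)
    (memory [::] w1 w2 w3 w4 [::] [::] w7 w8 [::] (ones (minn (s * 2 + b) K)) (ones K) [::] w19)
    (N * 40 + 20) 0.
Proof.
move=> sN KN; apply: exec_conv.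
- apply: exec_seq; first by apply: (exec_add_ones (n := s) _ _ _ _ _).
  apply: exec_seq; first exact: exec_emit.
  apply: exec_seq; first exact: exec_clear.
  pose I i := memory [::] w1 w2 w3 w4 [::] [::] w7 w8 [::] (ones (minn (s * 2 + b) i))
    (ones K) (ones (s * 2 + b - i)) w19.
  apply: exec_seq _ (exec_clear _ _).
  apply: (exec_for_ones (n := K) (T := 2) (Q := 0) (I := I) _ _ erefl) => //.
    rewrite /I minn0 subn0; memories.
    by rewrite cats0 /ones -nseqD addnC.
  move=> i lt_i; case: (leqP (s * 2 + b) i) => [le_i|lt_ib].
    have -> : I i.+1 = I i.
      by rewrite /I; congr memory; congr ones; lia.
    apply: exec_pop_empty; last exact: exec_skip.
    by rewrite /st /update /I /=; have -> : s * 2 + b - i = 0 by lia.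
  apply: (exec_pop (b := true) (w := ones (s * 2 + b - i.+1))).
    by rewrite /st /update /I /=; have -> : s * 2 + b - i = (s * 2 + b - i.+1).+1 by lia.
  apply: exec_conv; [exact: exec_push | | by [] | by []].
  rewrite /I; have -> : minn (s * 2 + b) i = i by lia.
  have -> : minn (s * 2 + b) i.+1 = i.+1 by lia.
  by memories.
- by memories.
- rewrite /st /update /memory /= !size_nseq; case: b; lia.
- by rewrite muln0.
Qed.

Definition value (bs : seq bool) := foldr (fun (b : bool) s => s * 2 + b) 0 bs.

Lemma exec_clamp_bound N K w1 w2 w3 w4 w7 w8 c bs :
  c <= N -> K <= N -> size bs <= N ->
  exec clamp_bound
    (memory [::] w1 w2 w3 w4 [::] [::] w7 w8 [::] (ones c) (ones K) [::] (rev bs))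
    (memory [::] w1 w2 w3 w4 [::] [::] w7 w8 [::] (ones (minn (value bs) K)) (ones K) [::] [::])
    (N * 3 + 1 + (N * (N * 40 + 22) + 1)) 0.
Proof.
move=> cN KN bsN.
pose m us vs := memory [::] w1 w2 w3 w4 [::] [::] w7 w8 [::]
   (ones (minn (value us) K)) (ones K) [::] (rev vs).
have R us vs : size vs <= N ->
    exec (While 19 (Pop 19 Skip (clamp_step false) (clamp_step true)))
      (m us vs) (m (vs ++ us) [::]) (size vs * (N * 40 + 22) + 1) 0.
  elim/last_ind: vs us => [|vs b IH] us svs; first exact: exec_while_stop.
  rewrite size_rcons in svs *.
  apply: exec_conv.
  - apply: exec_while_step; first by rewrite /m rev_rcons.
    + apply: (exec_pop (b := b) (w := rev vs)); first by rewrite /m rev_rcons.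
      have -> : forall b : bool,
        (if b then clamp_step true else clamp_step false) = clamp_step b by case.
      apply: exec_conv_eq.
      * apply: (exec_clamp_step (N := N) (K := K) (s := minn (value us) K)
          w1 w2 w3 w4 w7 w8 (rev vs) b) => //; lia.
      * by rewrite /m; memories.
      * exact: erefl.
      * exact: leqnn.
      * exact: leqnn.
    apply: exec_conv_eq;
      [apply: (IH (b :: us)); lia | | exact: erefl | exact: leqnn | exact: leqnn].
    (* Clamping before the doubling does not change the clamped result. *)
    rewrite /m /=; congr memory; congr ones; lia.
  - by rewrite cat_rcons.
  - by rewrite /=; nia.
  - by [].
apply: exec_conv.
- apply: exec_seq_eq; first exact: exec_clear; last exact: (R [::] bs).
  by rewrite /m min0n; memories.
- by rewrite cats0.
- by rewrite /memory /= size_nseq; nia.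
- by [].
Qed.

Lemma value_binary s : value (binary s) = s.
Proof.
have : s < 2 ^ up_log 2 s.+1 by apply: up_logP.
rewrite /binary; move: (up_log 2 s.+1) => j; elim: j s => [|j IH] s;
  first by rewrite expn0; case: s.
rewrite expnS => lt_s.
have -> : mkseq (fun i => odd (s %/ 2 ^ i)) j.+1 =
    odd s :: mkseq (fun i => odd (s %/ 2 %/ 2 ^ i)) j.
  rewrite /mkseq /= expn0 divn1 (iotaDl 1 0) -map_comp; congr cons.
  by apply: eq_map => i /=; rewrite add1n expnS divnMA.
rewrite /= IH; last by rewrite ltn_divLR // mulnC.
by rewrite -modn2 -divn_eq.
Qed.

(** * Binary search *)

(** [SAT] is a proposition; excluded middle picks the query rule that applies. *)
Lemma exec_oracle m r : exists b,
  exec (Query r) m (update m r [:: b]) 1 1 /\ (b <-> SAT (m r)).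
Proof.
case: (classic (SAT (m r))) => H.
  by exists true; split=> //; exists 1, 1; split=> //; apply: run_query_yes.
by exists false; split=> //; exists 1, 1; split=> //; apply: run_query_no.
Qed.

Definition ask := Seq (compile 0 query) (Query 0).

Section Search.

Context (N n t : nat) (phi : cnf n) (C : {set 'I_n}) (u : seq bool).

Definition side := (n + t).+1.

Context (sideN : side * side <= N) (phiN : size (encode_cnf phi ++ u) <= N).

Definition loaded w0 s k w16 w17 w18 w19 := memory w0 (ones n) (ones t)
  (concrete_bits C) (encode_cnf phi ++ u) (ones s) (ones k)
  (ones side) (ones (side * side)) [::] w16 w17 w18 w19.

Lemma exec_ask s k w16 w17 w18 w19 : s <= N -> k <= N -> exists b : bool,
  exec ask (loaded [::] s k w16 w17 w18 w19) (loaded [:: b] s k w16 w17 w18 w19)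
    (cost N query + 1) 1 /\ (b <-> coverable t phi C s k).
Proof.
move=> sN kN; set m := loaded _ _ _ _ _ _ _.
(* Numbers are in unary, so the size of a stack is its value. *)
pose env r := size (m r).
have leN : n + t < N by move: sideN; rewrite /side; nia.
have [env1 [env2 [env5 env6]]] : env 1 = n /\ env 2 = t /\ env 5 = s /\ env 6 = k.
  by rewrite /env /= !size_nseq.
have [env7 env8] : env 7 = side /\ env 8 = side * side.
  by rewrite /env /= !size_nseq.
have wfm : wf N phi (concrete_bits C) 0 env m.
  constructor; rewrite ?size_concrete_bits //; try lia.
  - by constructor; rewrite ?env2 ?env7 ?env8 //; rewrite /side; lia.
  - move=> r; rewrite /lv double0 addn0 => lr; have ->: r = (r - 20).+4.+4.+4.+4.+4 by lia.
    by rewrite /m /loaded /memory /= nth_nil.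
  - move=> r; rewrite /scoped /lv; have -> : [&& 20 <= r, r < 20 + 0.*2 & ~~ odd r] = false by lia.
    rewrite orbF !inE => /or4P[] /eqP ->; rewrite ?env1 ?env2 ?env5 ?env6;
      split=> //; lia.
  - by exists u.
have [b [Rb bP]] := exec_oracle (update m 0 (encode_formula
  (denote phi (concrete_bits C) 0 env query) ++ m 0)) 0.
exists b; split.
  apply: exec_conv.
  - by apply: exec_seq (compileP _ wfm) Rb.
  - by rewrite /m /loaded; memories.
  - by [].
  - by [].
rewrite bP /update /= cats0 sat_query ?env2 ?env5 ?env6 ?env7 ?env8 //; rewrite /side; lia.
Qed.

(** Two units are taken per round, one for 19 and one for 10; an odd last one goes to 19, which thus
    gets the upper half. *)
Definition split_width :=
  Seq (While 18 (Pop 18 Skip Skip (Seq (Push 19 true)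
        (Pop 18 Skip Skip (Push 10 true)))))
      (move_word 10 18).

Lemma exec_split_width s k w16 w17 d : d <= N ->
  exec split_width (loaded [::] s k w16 w17 (ones d) [::])
    (loaded [::] s k w16 w17 (ones d./2) (ones (uphalf d))) (N * 8 + 2) 0.
Proof.
move=> dN.
pose m d a b := update (loaded [::] s k w16 w17 (ones d) (ones a)) 10 (ones b).
have R e a b : exec (While 18 (Pop 18 Skip Skip (Seq (Push 19 true)
        (Pop 18 Skip Skip (Push 10 true))))) (m e a b)
    (m 0 (a + uphalf e) (b + e./2)) (e * 5 + 1) 0.
  have [j] := ubnP e; elim: j e a b => // j IH e a b; rewrite ltnS => ej.
  case: e ej => [|[|e]] ej.
  - by apply: exec_conv; [exact: exec_while_stop | rewrite /= !addn0 | |].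
  - apply: exec_conv.
    + apply: exec_while_step; first by [].
        apply: (exec_pop (b := true) (w := [::])); first by [].
        apply: exec_seq; first exact: exec_push.
        by apply: exec_pop_empty; last exact: exec_skip.
      exact: exec_while_stop.
    + by rewrite /= addn1 addn0 /m /loaded; memories.
    + by [].
    + by [].
  - apply: exec_conv.
    + apply: exec_while_step; first by [].
        apply: (exec_pop (b := true) (w := ones e.+1)); first by [].
        apply: exec_seq; first exact: exec_push.
        apply: (exec_pop (b := true) (w := ones e)); first by [].
        exact: exec_push.
      apply: exec_conv_eq; [apply: (IH e a.+1 b.+1); lia | | exact: erefl
        | exact: leqnn | exact: leqnn].
      by rewrite /m /loaded; memories.
    + by rewrite /= !addSnnS.
    + by rewrite /=; lia.
    + by [].
apply: exec_conv.
- apply: exec_seq; last exact: exec_move_word.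
  apply: exec_conv_eq (R d 0 0) _ erefl (leqnn _) (leqnn _).
  by rewrite /m /loaded; memories.
- by rewrite /m /loaded; memories; rewrite // cats0 /ones rev_nseq.
- rewrite /m /update /= size_nseq; have := odd_double_half d; lia.
- by [].
Qed.

(** The candidate [k + uphalf d] is built on stack 6 before the query and taken back when the answer
    is no. *)
Definition search_step :=
  Seq split_width (Seq (add_ones 1 19 9 6) (Seq ask
  (Seq (Pop 0 Skip (for_ones 19 9 (Pop 6 Skip Skip Skip)) Skip) (clear 19)))).

Definition cost_search_step := N * 40 + cost N query + 30.

Lemma exec_search_step s k w16 w17 d : s <= N -> k + d <= N ->
  exists k', exec search_step
    (loaded [::] s k w16 w17 (ones d) [::])
    (loaded [::] s k' w16 w17 (ones d./2) [::]) cost_search_step 1 /\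
  (coverable t phi C s (k + uphalf d) /\ k' = k + uphalf d \/
   ~ coverable t phi C s (k + uphalf d) /\ k' = k).
Proof.
move=> sN kdN; have dN : d <= N by lia.
have hN : uphalf d <= N by have := uphalf_half d; have := odd_double_half d; lia.
have khN : k + uphalf d <= N.
  by have := uphalf_half d; have := odd_double_half d; lia.
have [b [Rb bP]] := exec_ask w16 w17 (ones d./2) (ones (uphalf d)) sN khN.
exists (if b then k + uphalf d else k); split; last first.
  by case: b bP {Rb} => -[bP bP']; [left; split=> //; apply: bP | right; split=> // /bP'].
apply: exec_conv.
- apply: exec_seq; first exact: exec_split_width.
  apply: (exec_seq_eq (m1' := loaded [::] s (k + uphalf d) w16 w17 (ones d./2)
    (ones (uphalf d)))); first by apply: (exec_add_ones (n := uphalf d) _ _ _ _ _).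
    by rewrite /loaded; memories; rewrite // muln1 /ones -nseqD addnC.
  apply: exec_seq; first exact: Rb.
  apply: (exec_seq (T1 := (N * 10 + 2).+1) (Q1 := 0)
    (m1 := loaded [::] s (if b then k + uphalf d else k) w16 w17
    (ones d./2) (ones (uphalf d)))); last exact: exec_clear.
  apply: (exec_pop (b := b) (w := [::])); first by [].
  case: (b).
    apply: exec_conv; [exact: exec_skip | | lia | by []].
    by rewrite /loaded; memories.
  apply: exec_conv.
  + apply: (exec_for_ones (n := uphalf d) (T := 2) (Q := 0) (I := fun i =>
      loaded [::] s (k + uphalf d - i) w16 w17 (ones d./2) (ones (uphalf d))) _ _ erefl) => //.
      by rewrite subn0 /loaded; memories.
    move=> i lt_i; have -> : k + uphalf d - i = (k + uphalf d - i.+1).+1 by lia.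
    apply: (exec_pop (b := true) (w := ones (k + uphalf d - i.+1))); first by [].
    apply: exec_conv; [exact: exec_skip | | by [] | by []].
    by rewrite /loaded; memories.
  + by rewrite /= addnK /loaded; memories.
  + nia.
  + by rewrite muln0.
- by rewrite /loaded; memories.
- rewrite /cost_search_step /loaded /memory /= size_nseq; nia.
- by [].
Qed.

Definition search := While 18 search_step.

(** The threshold lies in [[k, k + d]]. After yes it lies in [[k + uphalf d, k + d]], after no
    strictly below [k + uphalf d]; either way the width is at most [d./2], so [j] queries exhaust a
    width below [2 ^ j]. *)
Lemma exec_search s mx w16 w17 j k d : s <= N -> k + d <= N ->
  (forall l, coverable t phi C s l <-> l <= mx) ->
  k <= mx <= k + d -> d < 2 ^ j ->
  exec search (loaded [::] s k w16 w17 (ones d) [::])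
    (loaded [::] s mx w16 w17 [::] [::]) (j * cost_search_step.+1 + 1) j.
Proof.
move=> sN + maxP; elim: j k d => [|j IH] k d kdN kmx lt_d.
  have d0 : d = 0 by move: lt_d; rewrite expn0; lia.
  have -> : mx = k by lia.
  by rewrite d0; apply: exec_conv; [exact: exec_while_stop | | | ].
have hd : uphalf d + d./2 = d by have := uphalf_half d; have := odd_double_half d; lia.
case: (posnP d) => [d0|d_gt0].
  have -> : mx = k by lia.
  rewrite d0; apply: exec_conv; [exact: exec_while_stop | by [] | lia | by []].
have [k' [R kP]] := exec_search_step w16 w17 sN kdN.
apply: exec_conv.
- apply: exec_while_step R _; first by case: (d) d_gt0.
  apply: IH.
  + by case: kP => -[_ ->]; lia.
  + have := uphalf_half d.
    by case: kP => -[/maxP H ->]; [| move: H => /negP]; case: (odd d); lia.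
  + by move: lt_d; rewrite expnS; have := odd_double_half d; lia.
- by [].
- by rewrite mulSn; lia.
- by [].
Qed.

End Search.

(** * Polynomial bounds and the whole program *)

(** A single parameter as shift and exponent can be enlarged at will, which eases closure under sums
    and products; the usual form is recovered at the end. *)
Definition poly_bounded (f : nat -> nat) := exists a, forall x, f x <= (x + a) ^ a.

Lemma poly_const c : poly_bounded (fun=> c).
Proof.
exists c => x; case: c => // c; apply: leq_trans (_ : c.+1 ^ c.+1 <= _).
  by rewrite -[X in X <= _]expn1 leq_pexp2l.
by rewrite leq_exp2r //; lia.
Qed.

Lemma poly_id : poly_bounded id.
Proof. by exists 1 => x; rewrite expn1 leq_addr. Qed.

Lemma poly_widen f a b : (forall x, f x <= (x + a) ^ a) -> a <= b -> 0 < b ->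
  forall x, f x <= (x + b) ^ b.
Proof.
move=> fa ab b0 x; apply: leq_trans (fa x) _.
case: a ab {fa} => [|a] ab; first by rewrite expn0 expn_gt0; lia.
apply: leq_trans (_ : (x + b) ^ a.+1 <= _); first by rewrite leq_exp2r //; lia.
by rewrite leq_pexp2l //; lia.
Qed.

Lemma poly_add f g : poly_bounded f -> poly_bounded g ->
  poly_bounded (fun x => f x + g x).
Proof.
move=> [a fa] [b gb]; pose c := a + b + 1; exists c.+1 => x.
have {}fa : f x <= (x + c) ^ c by apply: (poly_widen fa); rewrite /c; lia.
have {}gb : g x <= (x + c) ^ c by apply: (poly_widen gb); rewrite /c; lia.
have E : (x + c) ^ c <= (x + c.+1) ^ c by rewrite leq_exp2r /c; lia.
(* The factor 2 is absorbed by one more power of a base that is at least 2. *)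
rewrite expnS; apply: leq_trans (_ : 2 * (x + c.+1) ^ c <= _); first lia.
by rewrite leq_mul2r /c; lia.
Qed.

Lemma poly_mul f g : poly_bounded f -> poly_bounded g ->
  poly_bounded (fun x => f x * g x).
Proof.
move=> [a fa] [b gb]; pose c := a + b + 1; exists (c + c) => x.
have {}fa : f x <= (x + c) ^ c by apply: (poly_widen fa); rewrite /c; lia.
have {}gb : g x <= (x + c) ^ c by apply: (poly_widen gb); rewrite /c; lia.
have E : (x + c) ^ c <= (x + (c + c)) ^ c by rewrite leq_exp2r /c; lia.
by rewrite expnD; apply: leq_mul; [apply: leq_trans fa E | apply: leq_trans gb E].
Qed.

Lemma poly_succ f : poly_bounded f -> poly_bounded (fun x => (f x).+1).
Proof.
move=> pf; have [a fa] := poly_add pf (poly_const 1).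
by exists a => x; rewrite -addn1.
Qed.

Lemma poly_double f : poly_bounded f -> poly_bounded (fun x => (f x).*2).
Proof.
move=> pf; have [a fa] := poly_add pf pf.
by exists a => x; rewrite -addnn.
Qed.

Lemma poly_exp f j : poly_bounded f -> poly_bounded (fun x => f x ^ j).
Proof.
move=> pf; elim: j => [|j [a fa]]; first exact: (poly_const 1).
have [b gb] := poly_mul pf (ex_intro _ a fa).
by exists b => x; rewrite expnS.
Qed.

Ltac poly := repeat first
  [ assumption | exact: poly_const | exact: poly_id | apply: poly_add
  | apply: poly_mul | apply: poly_succ | apply: poly_double | apply: poly_exp ].

Lemma poly_cost_var f : poly_bounded f -> poly_bounded (fun x => cost_var (f x)).
Proof. by move=> pf; rewrite /cost_var; poly. Qed.

Lemma poly_cost_cnf f : poly_bounded f -> poly_bounded (fun x => cost_cnf (f x)).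
Proof.
move=> pf; have pv := poly_cost_var pf.
by rewrite /cost_cnf /cost_lit; poly.
Qed.

Lemma poly_cost f e : poly_bounded f -> poly_bounded (fun x => cost (f x) e).
Proof.
move=> pf; have pv := poly_cost_var pf; have pc := poly_cost_cnf pf.
by elim: e => *; rewrite /=; poly.
Qed.

Definition main t := Seq read_features (Seq (emit 2 (ones t))
  (Seq (power_program t) (Seq set_sizes (Seq read_bound (Seq clamp_bound
  (Seq (add_ones 1 17 9 5) (Seq (add_ones 1 17 9 18) (Seq search
  (Seq (clear 5) (Seq (move_word 16 5) ask)))))))))).

Definition cost_main t N :=
  N * 26 + 20 + t.+1 + (1 + t * (N * (N * 10 + 9) + N * 6 + 4)) +
  (N * (N * 9 + 9) + N * 30 + 20) + (N * 11 + cost_cnf N * 4 + 20) +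
  (N * 3 + 1 + (N * (N * 40 + 22) + 1)) + (N * 9 + 2).*2 +
  (t * (N + 2) * (cost_search_step N).+1 + 1) + (N * 3 + 1).*2 +
  (cost N query + 1).

Lemma exec_main N t n (phi : cnf n) (C : {set 'I_n}) s :
  0 < t ->
  size (encode_instance (IspInstance phi C s)) <= N ->
  (n + t).+1 * (n + t).+1 <= N -> (forall i, i <= t -> (#|C| * 2) ^ i <= N) ->
  exists (m : store) (b : bool),
  [/\ exec (main t) (initial (encode_instance (IspInstance phi C s))) m
        (cost_main t N) (t * (trunc_log 2 #|C| + 2) + 1),
      m 0 = [:: b] & b <-> isp_decision t (IspInstance phi C s)].
Proof.
move=> t_gt0; set w := encode_cnf phi ++ encode_bits (binary s).
have -> : encode_instance (IspInstance phi C s) =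
  encode_unary n ++ concrete_bits C ++ w by [].
rewrite /encode_unary !size_cat size_nseq size_concrete_bits -/(encode_unary n) => sizeN sideN powN.
have nN : n <= N by lia.
have wN : size w <= N by rewrite size_cat; lia.
have Cn : #|C| <= n by rewrite -[X in _ <= X]card_ord max_card.
have CN : #|C| <= N by lia.
have bN : size (binary s) <= N.
  apply: leq_trans wN; rewrite size_cat.
  by have := size_encode_seq (fun b : bool => [:: b]) (binary s); lia.
set K := (#|C| * 2) ^ t.
have KN : K <= N by apply: powN.
set mx := #|feasible_tuples t phi C|.
have mxK : mx <= K by apply: card_feasible_tuples.
set L := trunc_log 2 #|C|.
have LN : L <= N.
  apply: leq_trans CN; rewrite /L; case: (posnP #|C|) => [->|C0]; first by [].
  by apply: leq_trans (trunc_logP (isT : 1 < 2) C0); apply: ltnW; apply: ltn_expl.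
(* [#|C| < 2 ^ (L + 1)], hence [#|C| * 2 < 2 ^ (L + 2)]. *)
have ltK : K < 2 ^ (t * (L + 2)).
  rewrite /K (mulnC t) expnM ltn_exp2r // addn2 expnSr ltn_pmul2r //.
  exact: trunc_log_ltn.
have minN : minn s K <= N by lia.
(* The concluding query, with [mx] as the search will find it; its answer is obtained first because
   the final store depends on it. *)
have [b [Rb bP]] := @exec_ask N n t phi C (encode_bits (binary s)) sideN wN (minn s K) mx
   [::] (ones K) [::] [::] minN (leq_trans mxK KN).
exists (loaded t phi C (encode_bits (binary s)) [:: b] (minn s K) mx [::] (ones K) [::] [::]), b.
split=> //; last first.
  by rewrite bP coverable_decision.
apply: exec_conv.
- apply: exec_seq.
    apply: exec_conv_eq;
      [apply: (exec_read_features (n := n) w (size_concrete_bits C)) |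
       | exact: erefl | exact: leqnn | exact: leqnn].
    by rewrite /initial; memories.
  rewrite count_concrete_bits.
  apply: (exec_seq_eq (m1' := memory [::] (ones n) (ones t) (concrete_bits C) w [::] [::] [::] [::]
    [::] (ones #|C|) [::] [::] [::])).
  + exact: exec_emit.
  + by memories; rewrite // cats0.
  apply: exec_seq; first exact: exec_power_program CN powN.
  apply: exec_seq; first by apply: (exec_set_sizes (N := N)); nia.
  apply: exec_seq; first by apply: (exec_read_bound (N := N)) => //; nia.
  apply: exec_seq; first exact: (exec_clamp_bound _ _ _ _ _ _ CN KN bN).
  rewrite value_binary.
  apply: exec_seq; first by apply: (exec_add_ones (n := K) _ _ _ _ _).
  apply: exec_seq; first by apply: (exec_add_ones (n := K) _ _ _ _ _).
  apply: (exec_seq (m1 := loaded t phi C (encode_bits (binary s)) [::] K mx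
    (ones (minn s K)) (ones K) [::] [::])).
    apply: exec_conv_eq.
    (* The search allows [K] configurations, where [coverable] has threshold [mx], and starts from
       the interval [[0, K]]. *)
    * apply: (@exec_search N n t phi C (encode_bits (binary s)) sideN wN K mx
        (ones (minn s K)) (ones K) (t * (L + 2)) 0 K) => //.
        by move=> l; apply: coverable_max.
    * by rewrite /loaded; memories; rewrite // muln1 cats0.
    * exact: erefl.
    * exact: leqnn.
    * exact: leqnn.
  apply: exec_seq; first exact: exec_clear.
  apply: exec_seq_eq _ _ Rb; first exact: exec_move_word.
  by rewrite /loaded; memories; rewrite // cats0 /ones rev_nseq.
- by [].
- rewrite /cost_main; move: (cost N query) => q.
  rewrite /update /loaded /memory /= !size_nseq.
  have : t * (L + 2) * (cost_search_step N).+1 <= t * (N + 2) * (cost_search_step N).+1.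
    by rewrite leq_mul2r leq_mul2l leq_add2r LN !orbT.
  by lia.
- lia.
Qed.

(** The summands dominate the input, the square of [n + t + 1] and the powers of [#|C| * 2]; the
    successor keeps the base positive, so that smaller exponents are covered too. *)
Definition stack_bound t S := S + (S + t).+1 * (S + t).+1 + (S * 2).+1 ^ t.

Lemma poly_cost_main t : poly_bounded (fun S => cost_main t (stack_bound t S)).
Proof.
have pN : poly_bounded (stack_bound t) by rewrite /stack_bound; poly.
have pc := poly_cost_cnf pN; have pq := poly_cost query pN.
by rewrite /cost_main /cost_search_step; poly.
Qed.

Lemma poly_boundedP f : poly_bounded f -> exists k, forall S, f S <= k * S ^ k + k.
Proof.
move=> [a fa]; pose k := a.+1 ^ a + a; exists k => S; apply: leq_trans (fa S) _.
case: (posnP S) => [->|S_gt0].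
  by rewrite add0n /k; apply: leq_trans (leq_addl _ _); apply: leq_trans (leq_addr _ _);
    case: (a) => // b; rewrite leq_exp2r.
(* For [S > 0], [S + a <= (a + 1) * S]; the resulting constant and exponent are both at most [k]. *)
apply: leq_trans (leq_addr _ _); apply: leq_trans (_ : (a.+1 * S) ^ a <= _).
  by case: (a) => // b; rewrite leq_exp2r // mulSn; nia.
rewrite expnMn leq_mul //; first by rewrite /k leq_addr.
by rewrite leq_pexp2l // /k leq_addl.
Qed.

(* The polynomial [k * N ^ k + k] bounds the running time.  The [.+1] after the
   logarithm only matters for at most one concrete feature, where [log] is zero
   or undefined. *)
Theorem theorem4p1 (t : nat) (ht : 1 <= t) :
  exists (p : program) (k c : nat),
    forall x : isp_instance,
      decides_within SAT p (encode_instance x) (isp_decision t x)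
        (k * size (encode_instance x) ^ k + k)
        (c * (trunc_log 2 #|concrete x|).+1).
Proof.
have [k timeP] := poly_boundedP (poly_cost_main t).
(* [t * (L + 2) + 1 <= (2 * t + 1) * (L + 1)] for the truncated logarithm [L]. *)
exists (main t), k, (2 * t + 1) => -[n phi C s]; set w := encode_instance _.
have nw : n <= size w.
  by rewrite /w /encode_instance /encode_unary !size_cat size_nseq /=; lia.
have [|||m [b [[i [j [R iT jQ]]] m0 bP]]] :=
  @exec_main (stack_bound t (size w)) t n phi C s ht.
- by rewrite -/w /stack_bound; lia.
- rewrite /stack_bound; apply: leq_trans (leq_addr _ _); apply: leq_trans (leq_addl _ _).
  by apply: leq_mul; lia.
- move=> l lt; apply: leq_trans (leq_addl _ _).
  apply: leq_trans (_ : (size w * 2).+1 ^ l <= _); last by rewrite leq_pexp2l.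
  have Cn : #|C| <= n by rewrite -[X in _ <= X]card_ord max_card.
  by case: l {lt} => // l; rewrite leq_exp2r //; lia.
exists m, i, j, b; split=> //; first exact: leq_trans iT (timeP _).
by apply: leq_trans jQ _; rewrite /=; nia.
Qed.
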